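(* Let $n\ge2$ and $d\ge1$ be integers. Let $F(\mathbf X)\in\mathbb Z[\mathbf X]$ be a decomposable form of degree $d$ in $n$ variables. If $V(F)$ is finite and $F$ does not vanish at any non-trivial (nonzero) rational point, then $$V(F)\ll\mathfrak m(F)^{-n/d}\bigl(1+|\log\mathfrak m(F)|\bigr)^{n-1},$$ where the implicit constant depends only on $n$ and $d$.
   Context: A decomposable form of degree $d$ in $n$ variables is a homogeneous polynomial $F(\mathbf X)$ of degree $d$ in $\mathbf X=(X_1,\dots,X_n)$ that factors over $\mathbb C$ as $F(\mathbf X)=\prod_{i=1}^dL_i(\mathbf X)$ with (nonzero) linear forms $L_i$; $\mathbf L_i\in\mathbb C^n$ denotes the coefficient vector of $L_i$. $V(F)$ is the $n$-dimensional volume of $\{\mathbf x\in\mathbb R^n: |F(\mathbf x)|\le 1\}$. With $\|\cdot\|$ the $L^2$ (Hermitian) norm, the height is $\mathcal H(F)=\prod_{i=1}^d\|\mathbf L_i\|$, and $$\mathfrak m(F)=\inf\{\mathcal H(F\circ T): T\in\mathrm{GL}_n(\mathbb R),\ |\det T|=1\},$$ where $F\circ T$ is the form $F(T\mathbf x)$. When $V(F)$ is finite, $\mathfrak m(F)>0$. *)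

(* Defs.v *)
From HB Require Import structures.
From mathcomp Require Import all_boot all_order all_algebra.
From mathcomp Require mpoly.
(* Some notations of [mpoly] are incompatible with those of [all_analysis];
   both files define [isMeasure], the one of [all_analysis] is wanted. *)
Import -(notations) mpoly.
From mathcomp Require Import all_classical all_reals all_analysis.
From mathcomp Require Import complex.

Set Implicit Arguments.
Unset Strict Implicit.
Unset Printing Implicit Defensive.

Import Order.TTheory GRing.Theory Num.Theory.
Import numFieldNormedType.Exports.

Local Open Scope classical_set_scope.
Local Open Scope ring_scope.

Notation "{ 'mpoly' T [ n ] }" := (mpoly.mpoly n T)
  (at level 0, T at level 2, n at level 2, format "{ 'mpoly'  T [ n ] }").

Section LebesgueTuple.
Variable R : realType.
Local Notation mR := (measurableTypeR R).

Definition tcons n (p : mR * n.-tuple mR) : n.+1.-tuple mR :=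
  [tuple of p.1 :: p.2].

Lemma measurable_tcons n : measurable_fun setT (@tcons n).
Proof. exact: measurable_cons. Qed.

Section step.
Variables (n : nat) (mu : {sigma_finite_measure set (n.-tuple mR) -> \bar R}).

Let pm : {measure set (mR * n.-tuple mR) -> \bar R} :=
  (@lebesgue_measure R \x mu)%E.

Definition leb_step : set (n.+1.-tuple mR) -> \bar R :=
  pushforward (@lebesgue_measure R \x mu)%E (@tcons n).

Let leb_step0 : leb_step set0 = 0%E.
Proof. by rewrite /leb_step /pushforward preimage_set0 (measure0 pm). Qed.

Let leb_step_ge0 A : (0 <= leb_step A)%E.
Proof. exact: (measure_ge0 pm). Qed.

Let leb_step_sigma_additive : semi_sigma_additive leb_step.
Proof.
move=> F mF tF mUF; rewrite /leb_step /pushforward preimage_bigcup.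
apply: (@measure_semi_sigma_additive _ _ _ pm).
- by move=> i; rewrite -[X in measurable X]setTI; exact: measurable_tcons.
- apply/trivIsetP => /= i j _ _ ij; rewrite -preimage_setI.
  by move/trivIsetP : tF => /(_ _ _ _ _ ij) -> //; rewrite preimage_set0.
- rewrite -preimage_bigcup -[X in measurable X]setTI.
  exact: measurable_tcons.
Qed.

HB.instance Definition _ := isMeasure.Build _ _ _ leb_step
  leb_step0 leb_step_ge0 leb_step_sigma_additive.

Let leb_step_sigma_finite : sigma_finite setT leb_step.
Proof.
have /sigma_finiteP[F1 [TF1 ndF1 F1oo]] := sigma_finiteT (@lebesgue_measure R).
have /sigma_finiteP[F2 [TF2 ndF2 F2oo]] := sigma_finiteT mu.
pose uncons (t : n.+1.-tuple mR) : mR * n.-tuple mR :=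
  (thead t, [tuple of behead t]).
have unconsK t : tcons (uncons t) = t by rewrite /tcons -tuple_eta.
have tconsK p : uncons (tcons p) = p.
  by case: p => x t; congr pair; apply/val_inj.
have muncons : measurable_fun setT uncons.
  apply: measurable_fun_pair; last exact: measurable_behead.
  exact: measurable_tnth.
exists (fun i => uncons @^-1` (F1 i `*` F2 i)).
  apply/esym; rewrite -subTset => t _.
  have [i _ F1i] : (\bigcup_i F1 i) (uncons t).1 by rewrite -TF1.
  have [j _ F2j] : (\bigcup_i F2 i) (uncons t).2 by rewrite -TF2.
  exists (maxn i j) => //; split.
  - by move: F1i; exact/subsetPset/ndF1/leq_maxl.
  - by move: F2j; exact/subsetPset/ndF2/leq_maxr.
move=> i; have [mF1 F1oo'] := F1oo i; have [mF2 F2oo'] := F2oo i; split.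
  by rewrite -[X in measurable X]setTI; apply: muncons => //; exact: measurableX.
rewrite /= /leb_step /pushforward (_ : _ @^-1` _ = F1 i `*` F2 i).
  by rewrite product_measure1E// lte_mul_pinfty// ge0_fin_numE.
by apply/funext => p; rewrite -[in RHS](tconsK p).
Qed.

HB.instance Definition _ := Measure_isSigmaFinite.Build _ _ _ leb_step
  leb_step_sigma_finite.

End step.

(* Lebesgue measure on R^n, as an iterated product measure carried over to
   n.-tuple R; lebesgue_tuple_box shows that this is the usual normalization. *)
Fixpoint lebesgue_tuple n : {sigma_finite_measure set (n.-tuple mR) -> \bar R} :=
  match n with
  | 0 => \d_ [tuple]
  | n'.+1 => leb_step (lebesgue_tuple n')
  end.

Lemma lebesgue_tuple_box n (A : 'I_n -> set mR) :
  (forall i, measurable (A i)) ->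
  lebesgue_tuple n [set t | forall i, A i (tnth t i)] =
  (\prod_(i < n) lebesgue_measure (A i))%E.
Proof.
elim: n A => [|n IHn] A mA.
  rewrite big_ord0 /= diracE mem_set//.
  by case.
have mB (i : 'I_n) : measurable (A (lift ord0 i)) by exact: mA.
rewrite big_ord_recl -IHn//= /leb_step /pushforward.
rewrite (_ : _ @^-1` _ =
  A ord0 `*` [set t | forall i, A (lift ord0 i) (tnth t i)]).
  rewrite product_measure1E//.
  rewrite (_ : [set t | _] = \bigcap_(i in [set: 'I_n])
    ((fun t : n.-tuple mR => tnth t i) @^-1` A (lift ord0 i))).
    apply: fin_bigcap_measurable => // i _.
    rewrite -[X in measurable X]setTI; exact: measurable_tnth.
  by apply/seteqP; split=> t /= h i; [move=> _|]; apply: h.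
apply/seteqP; split=> -[x t] /=.
  move=> h; split; first exact: (h ord0).
  by move=> i; have := h (lift ord0 i); rewrite tnthS.
move=> [Ax At] i; have [j ->|->] := unliftP ord0 i.
  by rewrite tnthS.
exact: Ax.
Qed.

End LebesgueTuple.

Section DecomposableForm.
Variables (R : realType) (n : nat).
Local Notation C := (R[i]).

Definition linear_form (v : 'rV[C]_n) : {mpoly C[n]} :=
  \sum_(j < n) v 0 j *: mpolyX C (mnm1 j).

Definition hermitian_norm (v : 'rV[C]_n) : R :=
  Num.sqrt (\sum_(j < n) Normc.normc (v 0 j) ^+ 2).

Definition is_factorization (d : nat) (F : {mpoly R[n]})
    (L : 'I_d -> 'rV[C]_n) :=
  (forall i, L i != 0) /\
  map_mpoly (real_complex R) F = \prod_(i < d) linear_form (L i).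

Definition decomposable_form (d : nat) (F : {mpoly R[n]}) :=
  F \is ishomog1 d mdeg /\ exists L : 'I_d -> 'rV[C]_n, is_factorization F L.

(* The product does not depend on the factorization, the factors L i being
   unique up to order and to scalars of product 1; the value 0 is a default
   for F without factorization. *)
Definition height (d : nat) (F : {mpoly R[n]}) : R :=
  xget 0 [set h | exists L : 'I_d -> 'rV[C]_n,
    is_factorization F L /\ h = \prod_(i < d) hermitian_norm (L i)].

(* F(T x): 'X_i is replaced with \sum_j T i j 'X_j. *)
Definition form_comp (F : {mpoly R[n]}) (T : 'M[R]_n) : {mpoly R[n]} :=
  comp_mpoly [tuple \sum_(j < n) T i j *: mpolyX R (mnm1 j) | i < n] F.

Definition min_height (d : nat) (F : {mpoly R[n]}) : R :=
  inf [set height d (form_comp F T) | T in [set T : 'M[R]_n | `|\det T| = 1]].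

Definition form_volume (F : {mpoly R[n]}) : \bar R :=
  lebesgue_tuple R n [set x | `|meval (tnth x) F| <= 1].

End DecomposableForm.

(* Main.v *)
Require Import Defs.
From mathcomp Require Import all_boot all_order all_algebra.
From mathcomp Require Import fingroup perm.
From mathcomp Require mpoly.
Import -(notations) mpoly.
From mathcomp Require Import all_classical all_reals all_analysis.
From mathcomp Require Import measurable_realfun.
From mathcomp Require Import complex lra ring.

Set Implicit Arguments.
Unset Strict Implicit.
Unset Printing Implicit Defensive.

Import Order.TTheory GRing.Theory Num.Theory.
Import numFieldNormedType.Exports.
Local Open Scope classical_set_scope.
Local Open Scope ring_scope.

(* Let L_1, ..., L_d be the factors of F and m the minimal height. For a point
   x with 0 < |F(x)| <= 1, choose among the real and imaginary parts of the L_j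
   an independent n-tuple I minimizing P = prod_k b_k / |det I|, where b_k is
   the absolute value at x of the factor the k-th member of I comes from. By
   Cramer's rule every coordinate c_k of a part of L_j in the basis I satisfies
   |c_k| b_k <= |L_j(x)|. So the linear map T taking the unit cube to the box
   |I_k| <= b_k gives |L_j o T| << |L_j(x)|, and, |det T| being P, the
   definition of m yields m P^(d/n) << 1.

   If the volume is finite, then fewer than dk/n of the L_j lie in the span of
   k real forms, for 0 < k < n. Ordering the b_k, partial summation improves the
   bound on P by the factor (b_n / b_1)^(-1/d), at the price of a lower bound on
   the nonzero determinants of parts of the L_j. Such a bound, polynomial in m,
   is of Liouville type: since |F| >= 1 at the nonzero integer points, the
   lattice T^-1 Z^n has no short vectors when T nearly attains m, hence by
   Minkowski's theorem it has n independent vectors of length polynomial in m;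
   evaluated at these the L_j become, after scaling, algebraic integers of
   polynomially bounded size.

   Finally the points x are covered by the boxes |I_k| <= t 2^(o_k), where 2^(o_k)
   is the order of magnitude of b_k / b_1. For given I and o these are nested,
   so that only the largest one counts, and summing its volume over o gives
   m^(-n/d) times the (n-1)-st power of a quantity << 1 + |log m|. *)

(** * Lebesgue measure on R^n and linear maps *)

Section LinearChange.
Variable R : realType.
Local Notation mR := (measurableTypeR R).
Local Notation mu n := (lebesgue_tuple R n).

Lemma lebesgue_tupleS_fst n (A : set (n.+1.-tuple mR)) : measurable A ->
  mu n.+1 A = (\int[@lebesgue_measure R]_x mu n [set t | A (tcons (x, t))])%E.
Proof.
move=> mA; rewrite /= /leb_step /pushforward /product_measure1.
apply: eq_integral => x _ /=; congr (mu n _).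
by apply/seteqP; split => t /=; rewrite /xsection /= inE.
Qed.

(** The opposite order of integration: both iterated integrals give the product measure, by its
    uniqueness on measurable rectangles. *)
Lemma lebesgue_tupleS_snd n (A : set (n.+1.-tuple mR)) : measurable A ->
  mu n.+1 A = (\int[mu n]_t @lebesgue_measure R [set x | A (tcons (x, t))])%E.
Proof.
move=> mA; rewrite /= /leb_step /pushforward.
have mB : measurable (@tcons R n @^-1` A).
  by rewrite -[X in measurable X]setTI; exact: measurable_tcons.
have -> : (lebesgue_measure \x mu n)%E (@tcons R n @^-1` A) =
          (lebesgue_measure \x^ mu n)%E (@tcons R n @^-1` A).
  by apply: product_measure_unique => // B C mB' mC /=; rewrite product_measure2E.
rewrite /product_measure2.
apply: eq_integral => x _ /=; congr (lebesgue_measure _).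
by apply/seteqP; split => t /=; rewrite /ysection /= inE.
Qed.

(** The factor refers to preimages, so an invertible matrix [T] will have the factor [|\det T|^-1].
    Measurability is included to make the notion stable under composition. *)
Definition scales_volume d (T : measurableType d)
    (m : set T -> \bar R) (f : T -> T) (c : R) :=
  0 <= c /\ measurable_fun setT f /\
  forall A, measurable A -> m (f @^-1` A) = (c%:E * m A)%E.

Lemma scales_volume_comp d (T : measurableType d) (m : set T -> \bar R) f g a b :
  scales_volume m f a -> scales_volume m g b ->
  scales_volume m (f \o g) (a * b).
Proof.
move=> [a0 [mf fA]] [b0 [mg gA]]; split; first exact: mulr_ge0.
split; first exact: measurableT_comp.
move=> A mA; rewrite comp_preimage gA.
- by rewrite fA// muleA -EFinM (mulrC b).
- by rewrite -[X in measurable X]setTI; exact: mf.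
Qed.

Lemma measurable_slice_snd n (A : set (n.+1.-tuple mR)) x : measurable A ->
  measurable [set t : n.-tuple mR | A (tcons (x, t))].
Proof.
move=> mA; rewrite -[X in measurable X]setTI.
exact: (measurableT_comp (@measurable_tcons R n)).
Qed.

Lemma measurable_slice_fst n (A : set (n.+1.-tuple mR)) t : measurable A ->
  measurable [set x : mR | A (tcons (x, t))].
Proof.
move=> mA; rewrite -[X in measurable X]setTI.
exact: (measurableT_comp (@measurable_tcons R n)).
Qed.

(** Tonelli: it suffices that all slices are scaled by one and the same factor. *)
Lemma scales_volume_tcons_snd n (f : n.+1.-tuple mR -> n.+1.-tuple mR) g c :
  0 <= c -> measurable_fun setT f ->
  (forall x t, f (tcons (x, t)) = tcons (x, g x t)) ->
  (forall x, scales_volume (mu n) (g x) c) -> scales_volume (mu n.+1) f c.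
Proof.
move=> c0 mf fE gc; split => //; split => // A mA.
have mfA : measurable (f @^-1` A) by rewrite -[X in measurable X]setTI; exact: mf.
rewrite !lebesgue_tupleS_fst// -ge0_integralZl//.
- apply: eq_integral => x _.
  have [_ [_ <-]] := gc x; last exact: measurable_slice_snd.
  by congr (mu n _); apply/seteqP; split=> t /=; rewrite fE.
- have mB : measurable (@tcons R n @^-1` A).
    by rewrite -[X in measurable X]setTI; exact: measurable_tcons.
  apply: eq_measurable_fun (measurable_fun_xsection (mu n) mB) => x _ /=.
  by congr (mu n _); apply/seteqP; split => t /=; rewrite /xsection /= inE.
Qed.

Lemma scales_volume_tcons_fst n (f : n.+1.-tuple mR -> n.+1.-tuple mR) g c :
  0 <= c -> measurable_fun setT f ->
  (forall x t, f (tcons (x, t)) = tcons (g t x, t)) ->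
  (forall t, scales_volume (@lebesgue_measure R) (g t) c) ->
  scales_volume (mu n.+1) f c.
Proof.
move=> c0 mf fE gc; split => //; split => // A mA.
have mfA : measurable (f @^-1` A) by rewrite -[X in measurable X]setTI; exact: mf.
rewrite !lebesgue_tupleS_snd// -ge0_integralZl//.
- apply: eq_integral => x _.
  have [_ [_ <-]] := gc x; last exact: measurable_slice_fst.
  by congr (lebesgue_measure _); apply/seteqP; split=> t /=; rewrite fE.
- have mB : measurable (@tcons R n @^-1` A).
    by rewrite -[X in measurable X]setTI; exact: measurable_tcons.
  apply: eq_measurable_fun (measurable_fun_ysection lebesgue_measure mB) => x _ /=.
  by congr (lebesgue_measure _); apply/seteqP; split => t /=; rewrite /ysection /= inE.
Qed.

(** The push-forward of Lebesgue measure, multiplied by [|a|], agrees with Lebesgue measure on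
    half-open intervals, hence everywhere. *)
Lemma lebesgue_scales_affine (a b : R) : a != 0 ->
  scales_volume (@lebesgue_measure R) (fun x : mR => a * x + b : mR) `|a|^-1.
Proof.
move=> a0; have ma : measurable_fun setT (fun x : mR => a * x + b : mR).
  apply: measurable_funD => //; exact: measurable_funM.
split; first by rewrite invr_ge0.
split => // A mA.
pose push : {measure set mR -> \bar R} :=
  measure_function_pushforward__canonical__measure_function_Measure
    (@lebesgue_measure R) ma.
pose m' : {measure set mR -> \bar R} := mscale (NngNum (normr_ge0 a)) push.
have : lebesgue_measure A = m' A.
  apply: lebesgue_measure_unique => // X [[c d] _ <-] /=.
  rewrite /m' /mscale /= /pushforward /=.
  have -> : (fun x => a * x + b) @^-1` [set` `]c, d]] =
     [set` if 0 < a then `](c - b) / a, (d - b) / a] else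
        `[(d - b) / a, (c - b) / a[].
    apply/seteqP; split => x /=; rewrite in_itv/=.
    - case: (ltrgtP 0 a) a0 => // [a1|a1] _; rewrite in_itv/=.
        by rewrite ltr_pdivrMr// ler_pdivlMr// mulrC => /andP[h1 h2]; apply/andP; split; lra.
      by rewrite ltr_ndivlMr// ler_ndivrMr// mulrC => /andP[h1 h2]; apply/andP; split; lra.
    - case: (ltrgtP 0 a) a0 => // [a1|a1] _; rewrite in_itv/=.
        by rewrite ltr_pdivrMr// ler_pdivlMr// (mulrC x) => /andP[h1 h2]; apply/andP; split; lra.
      by rewrite ltr_ndivlMr// ler_ndivrMr// (mulrC x) => /andP[h1 h2]; apply/andP; split; lra.
  case: (ltrgtP 0 a) a0 => // [a1|a1] _; rewrite !lebesgue_measure_itv/= !lte_fin.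
    have -> : ((c - b) / a < (d - b) / a) = (c < d).
      by rewrite ltr_pdivrMr// divfK ?gt_eqF// ltrD2r.
    case: ifPn; rewrite ?mule0// => _.
    by rewrite -!EFinD -EFinM gtr0_norm//; congr EFin; field; rewrite gt_eqF.
  have -> : ((d - b) / a < (c - b) / a) = (c < d).
    by rewrite ltr_ndivrMr// divfK ?lt_eqF// ltrD2r.
  case: ifPn; rewrite ?mule0// => _.
  by rewrite -!EFinD -EFinM ltr0_norm//; congr EFin; field; rewrite lt_eqF.
rewrite /m' /mscale /push /pushforward /= => ->.
by rewrite muleA -EFinM mulVf ?normr_eq0// mul1e.
Qed.

Lemma scales_volume_ext d (T : measurableType d) (m : set T -> \bar R) f g a :
  f =1 g -> scales_volume m f a -> scales_volume m g a.
Proof. by move=> /funext ->. Qed.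

Definition tuple_shift n (v : 'I_n -> R) (x : n.-tuple mR) : n.-tuple mR :=
  [tuple tnth x i + v i | i < n].

Definition tuple_lin n (T : 'M[R]_n) (x : n.-tuple mR) : n.-tuple mR :=
  [tuple \sum_k T i k * tnth x k | i < n].

Lemma measurable_tuple_shift n (v : 'I_n -> R) :
  measurable_fun setT (tuple_shift v).
Proof.
apply/measurable_fun_tnthP => i; rewrite (_ : _ \o _ = fun x => tnth x i + v i).
  by apply: measurable_funD => //; exact: measurable_tnth.
by apply/funext => x /=; rewrite tnth_mktuple.
Qed.

Lemma measurable_linear_form n (u : 'I_n -> R) :
  measurable_fun setT (fun x : n.-tuple mR => \sum_k u k * tnth x k : mR).
Proof.
apply: (@measurable_sum _ _ _ _ _ _ (fun k x => u k * tnth x k)) => k.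
by apply: measurable_funM => //; exact: measurable_tnth.
Qed.

Lemma measurable_tuple_lin n (T : 'M[R]_n) : measurable_fun setT (tuple_lin T).
Proof.
apply/measurable_fun_tnthP => i.
rewrite (_ : _ \o _ = fun x => \sum_k T i k * tnth x k).
  exact: measurable_linear_form.
by apply/funext => x /=; rewrite tnth_mktuple.
Qed.

Lemma tnth_tcons0 n (p : mR * n.-tuple mR) : tnth (tcons p) ord0 = p.1.
Proof. by []. Qed.

Lemma tnth_tconsS n (p : mR * n.-tuple mR) i :
  tnth (tcons p) (lift ord0 i) = tnth p.2 i.
Proof. by rewrite tnthS. Qed.

Lemma scales_volume_shift n (v : 'I_n -> R) :
  scales_volume (mu n) (tuple_shift v) 1.
Proof.
elim: n v => [|n IH] v.
  split => //; split; first exact: measurable_tuple_shift.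
  move=> A mA; rewrite mul1e; congr (mu 0%N _).
  by apply/seteqP; split => x /=; rewrite (tuple0 (tuple_shift _ _)) (tuple0 x).
pose v0 := fun i => if i == ord0 then v i else 0.
pose v1 := fun i => if i == ord0 then 0 else v i.
rewrite -[1]mulr1.
apply: (@scales_volume_ext _ _ _ (tuple_shift v0 \o tuple_shift v1)).
  move=> x; apply: eq_from_tnth => i; rewrite !tnth_mktuple -addrA; congr (_ + _).
  by rewrite /v0 /v1; case: ifP; rewrite ?add0r ?addr0.
apply: scales_volume_comp.
- apply: (@scales_volume_tcons_fst _ _ (fun t x => 1 * x + v ord0)) => //.
  + exact: measurable_tuple_shift.
  + move=> x t; apply: eq_from_tnth => i; rewrite tnth_mktuple /v0.
    by case: (unliftP ord0 i) => [j ->|->]; rewrite ?tnth_tconsS ?tnth_tcons0/= ?mul1r ?addr0.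
  + by move=> t; have := lebesgue_scales_affine (v ord0) (oner_neq0 R); rewrite normr1 invr1.
- apply: (@scales_volume_tcons_snd _ _ (fun x => tuple_shift (fun i => v (lift ord0 i)))) => //.
  + exact: measurable_tuple_shift.
  + move=> x t; apply: eq_from_tnth => i; rewrite tnth_mktuple /v1.
    by case: (unliftP ord0 i) => [j ->|->]; rewrite ?tnth_tconsS ?tnth_tcons0/= ?tnth_mktuple ?addr0.
Qed.

Lemma tuple_linM n (S T : 'M[R]_n) : tuple_lin (S *m T) =1 tuple_lin S \o tuple_lin T.
Proof.
move=> x; apply: eq_from_tnth => i; rewrite !tnth_mktuple.
under eq_bigr do rewrite mxE mulr_suml.
rewrite exchange_big; apply: eq_bigr => j _; rewrite tnth_mktuple mulr_sumr.
by apply: eq_bigr => k _; rewrite mulrA.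
Qed.

Lemma tuple_lin1 n : tuple_lin (1%:M : 'M[R]_n) =1 id.
Proof.
move=> x; apply: eq_from_tnth => i; rewrite !tnth_mktuple (bigD1 i)//= big1.
  by rewrite mxE eqxx mul1r addr0.
by move=> k ki; rewrite mxE eq_sym (negPf ki) mul0r.
Qed.

Lemma tuple_lin_tcons n (T : 'M[R]_(1 + n)) x t :
  tuple_lin T (tcons (x, t)) =
  tcons (ulsubmx T 0 0 * x + \sum_k ursubmx T 0 k * tnth t k,
    [tuple dlsubmx T i 0 * x + \sum_k drsubmx T i k * tnth t k | i < n]).
Proof.
apply: eq_from_tnth => i; rewrite tnth_mktuple big_ord_recl tnth_tcons0/=.
case: (unliftP ord0 i) => [j ->|->]; rewrite ?tnth_tconsS ?tnth_tcons0/= ?tnth_mktuple.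
  rewrite mxE mxE lshift0 rshift1; congr (_ + _); apply: eq_bigr => k _.
  by rewrite tnth_tconsS 2!mxE !rshift1.
rewrite 2!mxE lshift0; congr (_ + _); apply: eq_bigr => k _.
by rewrite tnth_tconsS 2!mxE lshift0 rshift1.
Qed.

(** Gaussian elimination and induction on [n]. With a nonzero top left entry, [T] is a product of
    block matrices each of which fixes either the first coordinate or all the others, so Tonelli
    applies. A zero entry there is removed by adding another row to the first one. *)
Theorem scales_volume_lin n (T : 'M[R]_n) : T \in unitmx ->
  scales_volume (mu n) (tuple_lin T) `|\det T|^-1.
Proof.
elim: n T => [|n IH] T uT.
  split; first by rewrite invr_ge0.
  split; first exact: measurable_tuple_lin.
  move=> A mA; rewrite det_mx00 normr1 invr1 mul1e; congr (mu 0%N _).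
  by apply/seteqP; split => x /=; rewrite (tuple0 (tuple_lin _ _)) (tuple0 x).
rewrite -[n.+1]/(1 + n)%N in T uT *.
have lowerP (c : 'M[R]_(n, 1)) :
    scales_volume (mu n.+1) (tuple_lin (block_mx 1%:M 0 c 1%:M)) 1.
  apply: (@scales_volume_tcons_snd _ _ (fun x => tuple_shift (fun i => c i 0 * x))) => //.
  - exact: measurable_tuple_lin.
  - move=> x t; rewrite tuple_lin_tcons block_mxKul block_mxKur block_mxKdl block_mxKdr.
    congr (tcons (_, _)).
      by rewrite mxE eqxx mul1r big1 ?addr0// => k _; rewrite mxE mul0r.
    apply: eq_from_tnth => i; rewrite !tnth_mktuple addrC; congr (_ + _).
    by have := tuple_lin1 t; move/(congr1 (fun t => tnth t i)); rewrite tnth_mktuple.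
  - by move=> x; exact: scales_volume_shift.
have upperP a (b : 'M[R]_(1, n)) : a != 0 ->
    scales_volume (mu n.+1) (tuple_lin (block_mx a%:M b 0 1%:M)) `|a|^-1.
  move=> a0.
  apply: (@scales_volume_tcons_fst _ _ (fun t x => a * x + \sum_k b 0 k * tnth t k)) => //.
  - exact: measurable_tuple_lin.
  - move=> x t; rewrite tuple_lin_tcons block_mxKul block_mxKur block_mxKdl block_mxKdr.
    congr (tcons (_, _)); first by rewrite mxE eqxx mulr1n.
    apply: eq_from_tnth => i; rewrite !tnth_mktuple mxE mul0r add0r.
    by have := tuple_lin1 t; move/(congr1 (fun t => tnth t i)); rewrite tnth_mktuple.
  - by move=> t; exact: lebesgue_scales_affine.
have diagP (D : 'M[R]_n) : D \in unitmx ->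
    scales_volume (mu n.+1) (tuple_lin (block_mx (1%:M : 'M[R]_1) 0 0 D)) `|\det D|^-1.
  move=> uD.
  apply: (@scales_volume_tcons_snd _ _ (fun x => tuple_lin D)) => //.
  - exact: measurable_tuple_lin.
  - move=> x t; rewrite tuple_lin_tcons block_mxKul block_mxKur block_mxKdl block_mxKdr.
    congr (tcons (_, _)).
      by rewrite mxE eqxx mul1r big1 ?addr0// => k _; rewrite mxE mul0r.
    by apply: eq_from_tnth => i; rewrite !tnth_mktuple mxE mul0r add0r.
  - by move=> x; exact: IH.
have pivotP (S : 'M[R]_(1 + n)) : S \in unitmx -> ulsubmx S 0 0 != 0 ->
    scales_volume (mu n.+1) (tuple_lin S) `|\det S|^-1.
  move=> uS a0; set a := ulsubmx S 0 0 in a0.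
  (* The block factorization whose middle term contains the Schur complement of the pivot. *)
  have SE : S = block_mx 1%:M 0 (a^-1 *: dlsubmx S) 1%:M *m
      (block_mx 1%:M 0 0 (drsubmx S - a^-1 *: dlsubmx S *m ursubmx S) *m
       block_mx a%:M (ursubmx S) 0 1%:M).
    rewrite !mulmx_block !mul1mx !mulmx1 !mul0mx !mulmx0 !addr0 !add0r.
    rewrite addrC subrK -scalemxAl mul_mx_scalar scalerA mulVf// scale1r.
    rewrite -[LHS](submxK S); congr block_mx.
    by apply/matrixP => i j; rewrite !ord1 [RHS]mxE eqxx mulr1n.
  have dS : \det S = a * \det (drsubmx S - a^-1 *: dlsubmx S *m ursubmx S).
    rewrite {1}SE !det_mulmx det_lblock !det1 det_lblock det_ublock det1.
    by rewrite det_scalar1 det1 !mulr1 !mul1r mulrC.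
  have [_ uD] : a != 0 /\ drsubmx S - a^-1 *: dlsubmx S *m ursubmx S \in unitmx.
    by move: uS; rewrite !unitmxE dS !unitfE mulf_eq0 negb_or => /andP[].
  rewrite dS {1}SE normrM invfM -[X in scales_volume _ _ X]mul1r mulrA -mulrA [_^-1 * _]mulrC.
  apply: (@scales_volume_ext _ _ _ _ _ _ (fsym (tuple_linM _ _))).
  apply: scales_volume_comp => //.
  apply: (@scales_volume_ext _ _ _ _ _ _ (fsym (tuple_linM _ _))).
  by apply: scales_volume_comp; [exact: diagP|exact: upperP].
have [a0|] := eqVneq (ulsubmx T 0 0) 0; last exact: pivotP.
(* The first column of an invertible matrix is not zero. *)
have [k ck] : exists k, dlsubmx T k 0 != 0.
  apply/existsP; apply: contraT; rewrite negb_exists => /forallP /= c0.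
  move: uT; rewrite unitmxE unitfE -(submxK T).
  have -> : dlsubmx T = 0.
    by apply/matrixP => i j; rewrite ord1 (eqP (negbNE (c0 i))) mxE.
  by rewrite det_ublock [ulsubmx T]mx11_scalar a0 det_scalar1 mul0r eqxx.
pose e : 'M[R]_(1, n) := delta_mx 0 k.
pose E s : 'M[R]_(1 + n) := block_mx 1%:M (s *: e) 0 1%:M.
have dE s : \det (E s) = 1 by rewrite det_ublock !det1 mulr1.
have TE : T = E (-1) *m (E 1 *m T).
  rewrite mulmxA mulmx_block !mul1mx !mulmx1 !mul0mx !mulmx0 !addr0 !add0r.
  by rewrite scale1r scaleN1r subrr -scalar_mx_block mul1mx.
rewrite {1}TE -[_^-1]mul1r.
apply: (@scales_volume_ext _ _ _ _ _ _ (fsym (tuple_linM _ _))).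
apply: scales_volume_comp.
  by have := @upperP 1 (-1 *: e) (oner_neq0 _); rewrite normr1 invr1.
have -> : \det T = \det (E 1 *m T) by rewrite det_mulmx dE mul1r.
apply: pivotP; first by rewrite unitmxE det_mulmx dE mul1r -unitmxE.
rewrite -[T]submxK /E mulmx_block block_mxKul mul1mx scale1r mxE a0 add0r mxE.
rewrite (bigD1 k)//= big1 => [|i ik]; last by rewrite [e 0 i]mxE (negPf ik) andbF mul0r.
by rewrite addr0 [e 0 k]mxE !eqxx mul1r.
Qed.

End LinearChange.

(** Cramer's rule: the cofactors of row [p] do not see that row, so expanding along it pairs [u]
    with a column of the adjugate. *)
Lemma det_repl_row (K : fieldType) n (A : 'M[K]_n) p (u : 'rV_n) :
  A \in unitmx ->
  \det (\matrix_i (if i == p then u else row i A)) =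
  (u *m invmx A) 0 p * \det A.
Proof.
move=> uA; set B := \matrix_i _.
rewrite (expand_det_row B p) /invmx uA -scalemxAr mxE mulrAC mulVf.
  rewrite mul1r mxE; apply: eq_bigr => j _.
  rewrite !mxE eqxx; congr (_ * (_ * \det _)).
  apply/matrixP => i k; rewrite !mxE.
  by rewrite eq_sym (negPf (neq_lift _ _)) mxE.
by rewrite -unitfE -unitmxE.
Qed.

Section FiniteUnions.
Context d (T : measurableType d) (R : realType) (m : {measure set T -> \bar R}).
Variables (J : finType) (F : J -> set T).
Hypothesis mF : forall j, measurable (F j).

Lemma measurable_fin_union : measurable (\bigcup_j F j).
Proof. by apply: fin_bigcup_measurable => //; exact: finite_finset. Qed.

Lemma measure_fin_union_le : (m (\bigcup_j F j) <= \sum_j m (F j))%E.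
Proof.
have -> : \bigcup_j F j = \big[setU/set0]_(j <- index_enum J) F j.
  rewrite -bigcup_seq; apply: eq_bigcupl; split => // j _ /=.
  by rewrite mem_index_enum.
elim: (index_enum J) => [|j s IH]; first by rewrite !big_nil measure0.
rewrite !big_cons; apply: (le_trans (measureU2 _ _ _)) => //.
  by apply: bigsetU_measurable.
by rewrite leeD2l.
Qed.

Lemma measure_fin_union : trivIset setT F ->
  (m (\bigcup_j F j) = \sum_j m (F j))%E.
Proof.
move=> tF.
have -> : \bigcup_j F j = \big[setU/set0]_(j <- index_enum J) F j.
  rewrite -bigcup_seq; apply: eq_bigcupl; split => // j _ /=.
  by rewrite mem_index_enum.
elim: (index_enum J) (index_enum_uniq J) => [|j s IH /=]; first by rewrite !big_nil measure0.
move=> /andP[js us]; rewrite !big_cons measureU//; first by congr (_ + _)%E; exact: IH.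
  by apply: bigsetU_measurable.
rewrite -bigcup_seq; apply/seteqP; split => // x [Fj [i /= si Fi]].
have /trivIsetP/(_ j i I I) ji := tF.
suff : (F j `&` F i) x by rewrite ji//; apply: contraNneq js => ->.
by [].
Qed.

End FiniteUnions.

(** * Parallelepipeds and Minkowski's theorem on linear forms *)

Section Boxes.
Variable R : realType.
Local Notation mR := (measurableTypeR R).
Local Notation mu n := (lebesgue_tuple R n).

Lemma measurable_tuple_box n (A : 'I_n -> set mR) : (forall i, measurable (A i)) ->
  measurable [set t : n.-tuple mR | forall i, A i (tnth t i)].
Proof.
move=> mA; rewrite (_ : [set t | _] = \bigcap_(i in [set: 'I_n])
    ((fun t : n.-tuple mR => tnth t i) @^-1` A i)).
  apply: fin_bigcap_measurable => // i _.
  rewrite -[X in measurable X]setTI; exact: measurable_tnth.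
by apply/seteqP; split=> t /= h i; [move=> _|]; apply: h.
Qed.

Definition parallelepiped n (T : 'M[R]_n) (c : 'I_n -> R) : set (n.-tuple mR) :=
  [set x | forall i, `|\sum_k T i k * tnth x k| <= c i].

Lemma parallelepipedE n (T : 'M[R]_n) c :
  parallelepiped T c = tuple_lin T @^-1`
    [set t | forall i, [set y : mR | `|y| <= c i] (tnth t i)].
Proof.
by apply/seteqP; split => x /= h i; have := h i; rewrite tnth_mktuple.
Qed.

Lemma abs_le_itv (c : R) : [set y : R | `|y| <= c] = [set` `[- c, c]].
Proof. by apply/seteqP; split => y /=; rewrite in_itv/= ler_norml. Qed.

Lemma measurable_parallelepiped n (T : 'M[R]_n) c : measurable (parallelepiped T c).
Proof.
rewrite parallelepipedE -[X in measurable X]setTI.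
apply: measurable_tuple_lin => //; apply: (@measurable_tuple_box _ (fun i => [set y : mR | `|y| <= c i])) => i.
by rewrite abs_le_itv.
Qed.

Lemma lebesgue_abs_le (c : R) : 0 <= c ->
  lebesgue_measure ([set y : R | `|y| <= c] : set mR) = (2 * c)%:E.
Proof.
move=> c0; rewrite abs_le_itv lebesgue_measure_itv/= lte_fin.
case: ifPn => [_|]; first by rewrite -EFinD; congr EFin; ring.
by rewrite -leNgt => h; congr EFin; lra.
Qed.

Lemma volume_parallelepiped n (T : 'M[R]_n) c : T \in unitmx ->
  (forall i, 0 <= c i) ->
  mu n (parallelepiped T c) = (`|\det T|^-1 * \prod_i (2 * c i))%:E.
Proof.
move=> uT c0; rewrite parallelepipedE.
have [_ [_ ->]] := scales_volume_lin uT.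
  rewrite (@lebesgue_tuple_box _ _ (fun i => [set y : mR | `|y| <= c i])) => [|i]; last by rewrite abs_le_itv.
  rewrite (eq_bigr (fun i => (2 * c i)%:E)) => [|i _]; last exact: lebesgue_abs_le.
  by rewrite prodEFin.
by apply: (@measurable_tuple_box _ (fun i => [set y : mR | `|y| <= c i])) => i; rewrite abs_le_itv.
Qed.

(** Completing [u] to a basis makes the hyperplane the preimage of a box with one side reduced to a
    point. *)
Lemma volume_hyperplane n (u : 'rV[R]_n) : u != 0 ->
  mu n [set x | \sum_k u 0 k * tnth x k = 0] = 0%E.
Proof.
move=> /rV0Pn[p up]; pose T : 'M[R]_n := \matrix_i (if i == p then u else row i 1%:M).
have uT : T \in unitmx.
  rewrite unitmxE det_repl_row ?unitmx1// invmx1 mulmx1 det1 mulr1.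
  by rewrite unitfE.
have -> : [set x : n.-tuple mR | \sum_k u 0 k * tnth x k = 0] = tuple_lin T @^-1`
    [set t | forall i, (if i == p then [set 0] else setT) (tnth t i)].
  apply/seteqP; split => x /= h.
    move=> i; case: eqP => // ->; rewrite tnth_mktuple /=; apply: etrans h.
    by apply: eq_bigr => k _; rewrite mxE eqxx.
  have := h p; rewrite eqxx tnth_mktuple /=; apply: etrans.
  by apply: eq_bigr => k _; rewrite mxE eqxx.
have mA i : measurable (if i == p then [set 0] else setT : set mR).
  by case: ifP => // _; exact: measurable_set1.
pose B i : set mR := if i == p then [set 0] else setT.
have [_ [_ ->]] := scales_volume_lin uT; last exact: (@measurable_tuple_box _ B).
rewrite (@lebesgue_tuple_box _ _ B)// /B (bigD1 p)//= eqxx.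
by rewrite [X in (_ * (X * _))%E]lebesgue_measure_set1 mul0e mule0.
Qed.

(* Minkowski's theorem on linear forms, up to the factor [4 ^+ n]: counting the
   translates of one box in a fixed larger one avoids a passage to the limit. *)
Theorem weak_minkowski n (A : 'M[R]_n) (c : 'I_n -> R) : A \in unitmx ->
  (forall i, 0 < c i) -> 4 ^+ n * `|\det A| < \prod_i c i ->
  exists z : 'rV[int]_n, z != 0 /\
    forall i, `|\sum_j A i j * (z 0 j)%:~R| <= c i.
Proof.
move=> uA c0 cA; apply: contrapT => noz.
(* The sides are halved, so that the difference of two points of [K] satisfies the required
   bounds. *)
pose K := parallelepiped A (fun i => c i / 2).
have Kc (x : n.-tuple mR) i : K x -> `|tnth x i| <= \sum_i \sum_j `|invmx A i j| * c j.
  move=> Kx.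
  have -> : tnth x i = \sum_j invmx A i j * \sum_k A j k * tnth x k.
    have := tuple_lin1 x; rewrite -(mulVmx uA) tuple_linM /= => /(congr1 (fun t => tnth t i)).
    by rewrite tnth_mktuple => <-; apply: eq_bigr => j _; rewrite tnth_mktuple.
  rewrite [leRHS](bigD1 i)//= -[leLHS]addr0 lerD ?sumr_ge0//; last first.
    by move=> j _; apply: sumr_ge0 => k _; rewrite mulr_ge0// ltW.
  apply: le_trans (ler_norm_sum _ _ _) _; apply: ler_sum => j _.
  rewrite normrM ler_wpM2l//; apply: (le_trans (Kx j)).
  by have := c0 j; lra.
set r := \sum_i _ in Kc.
have r0 : 0 <= r.
  by apply: sumr_ge0 => i _; apply: sumr_ge0 => j _; rewrite mulr_ge0// ltW.
pose N := (Num.trunc r).+1.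
have rN : r < N%:R by exact: truncnS_gt.
(* The translates of [K] by the [N ^ n] integer vectors with coordinates in [0, N). *)
pose F (z : {ffun 'I_n -> 'I_N}) := tuple_shift (fun i => - (z i)%:R) @^-1` K.
have mF z : measurable (F z).
  rewrite -[X in measurable X]setTI; apply: measurable_tuple_shift => //.
  exact: measurable_parallelepiped.
have FK z : mu n (F z) = mu n K.
  have [_ [_ ->]] := scales_volume_shift (fun i => - (z i)%:R : R); first by rewrite mul1e.
  exact: measurable_parallelepiped.
(* A common point of two translates would make the difference of the translation vectors the integer
   point sought. *)
have tF : trivIset setT F.
  apply/trivIsetP => z1 z2 _ _ z12; apply/seteqP; split => // x [h1 h2].
  apply: noz; exists (\row_j ((z1 j)%:Z - (z2 j)%:Z)); split.
    apply: contraNneq z12 => /rowP z0; apply/eqP/ffunP => j; apply/val_inj.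
    by have := z0 j; rewrite !mxE => /eqP; rewrite subr_eq0 eqz_nat => /eqP.
  move=> i; have := h1 i; have := h2 i.
  under eq_bigr do rewrite tnth_mktuple mulrBr.
  rewrite sumrB => b2; under eq_bigr do rewrite tnth_mktuple mulrBr.
  rewrite sumrB => b1.
  under eq_bigr do rewrite mxE rmorphB/= mulrBr.
  rewrite sumrB; move: b1 b2; rewrite !ler_norml => /andP[] ? ? /andP[] ? ?.
  by apply/andP; split; lra.
(* As [r < N], all translates lie in a cube of side 4N. Comparing volumes, the powers of [N]
   cancel. *)
have : (mu n (\bigcup_z F z) <= mu n (parallelepiped 1%:M (fun=> (2 * N%:R)%R)))%E.
  apply: le_measure; rewrite ?inE.
  - exact: measurable_fin_union.
  - exact: measurable_parallelepiped.
  move=> x [z _ Fx] i.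
  have -> : \sum_k (1%:M : 'M[R]_n) i k * tnth x k = tnth x i.
    by have := tuple_lin1 x => /(congr1 (fun t => tnth t i)); rewrite tnth_mktuple.
  have := Kc _ i Fx; rewrite tnth_mktuple => h.
  have zN : (z i)%:R <= N%:R :> R by rewrite ler_nat ltnW.
  have z0 : 0 <= (z i)%:R :> R by exact: ler0n.
  by move: h; rewrite !ler_norml => /andP[] ? ?; apply/andP; split; lra.
rewrite measure_fin_union// (eq_bigr (fun=> mu n K)) => [|z _]; last exact: FK.
rewrite !volume_parallelepiped ?unitmx1//; last first.
  by move=> i; have := c0 i; lra.
rewrite sumEFin lee_fin det1 normr1 invr1 mul1r sumr_const card_ffun !card_ord.
under [X in _ * X]eq_bigr do rewrite mulrCA divff ?mulr1//.
under [leRHS]eq_bigr do rewrite mulrA.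
rewrite prodr_const card_ord exprMn -[_ *+ (N ^ n)]mulr_natl natrX.
have N0 : 0 < N%:R ^+ n :> R by rewrite exprn_gt0// ltr0n.
rewrite mulrC ler_pM2r// mulrC ler_pdivrMr ?normr_gt0 -?unitfE -?unitmxE//.
by rewrite -natrM leNgt cA.
Qed.

End Boxes.

(** * Heights *)

Section LinearForms.
Variable R : realType.
Local Notation K := (R[i]).

Lemma linear_form_comp n (W : 'M[K]_n) (v : 'rV[K]_n) :
  comp_mpoly [tuple linear_form (row i W) | i < n] (linear_form v) = linear_form (v *m W).
Proof.
rewrite /linear_form raddf_sum/=.
under eq_bigr do rewrite comp_mpolyZ comp_mpolyXU -tnth_nth tnth_mktuple scaler_sumr.
rewrite exchange_big /=; apply: eq_bigr => k _.
rewrite mxE scaler_suml; apply: eq_bigr => j _.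
by rewrite scalerA mxE.
Qed.

Lemma linear_form_coef n (v : 'rV[K]_n) j : mcoeff (mnm1 j) (linear_form v) = v 0 j.
Proof.
rewrite /linear_form raddf_sum/= (bigD1 j)//= mcoeffZ mcoeffX eqxx mulr1 big1 ?addr0//.
by move=> i ij; rewrite mcoeffZ mcoeffX eq_mnm1 (negPf ij) mulr0.
Qed.

Lemma linear_form_inj n : injective (@linear_form R n).
Proof. by move=> u v uv; apply/rowP => j; rewrite -!linear_form_coef uv. Qed.

Lemma linear_form0 n : linear_form (0 : 'rV[K]_n) = 0.
Proof. by rewrite /linear_form big1// => j _; rewrite mxE scale0r. Qed.

Lemma linear_form_eq0 n (v : 'rV[K]_n) : (linear_form v == 0) = (v == 0).
Proof. by rewrite -(inj_eq (@linear_form_inj n)) linear_form0. Qed.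

Lemma linear_formZ n c (v : 'rV[K]_n) : linear_form (c *: v) = c *: linear_form v.
Proof.
by rewrite /linear_form scaler_sumr; apply: eq_bigr => j _; rewrite mxE scalerA.
Qed.

(* Substituting 'X_p so that the form [u] vanishes kills a product containing
   [linear_form u]; the multiples of [linear_form u] are the only linear forms killed. *)
Lemma linear_form_dvd_prod n (u : 'rV[K]_n) (t : seq 'rV[K]_n) (P : {mpoly K[n]}) :
  u != 0 -> \prod_(v <- t) linear_form v = linear_form u * P ->
  exists2 v, v \in t & exists c, v = c *: u.
Proof.
move=> /rV0Pn[p up] tP.
pose W : 'M[K]_n := 1%:M - (u 0 p)^-1 *: (delta_mx p 0 *m u).
have WE v : v *m W = v - (v 0 p / u 0 p) *: u.
  rewrite mulmxBr mulmx1 -scalemxAr mulmxA.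
  have -> : v *m delta_mx p (0 : 'I_1) = (v 0 p)%:M.
    apply/matrixP => i j; rewrite !ord1 [RHS]mxE eqxx mulr1n mxE (bigD1 p)//= big1.
      by rewrite mxE !eqxx mulr1 addr0.
    by move=> k kp; rewrite mxE (negPf kp) mulr0.
  by rewrite mul_scalar_mx scalerA mulrC.
have : comp_mpoly [tuple linear_form (row i W) | i < n] (\prod_(v <- t) linear_form v) = 0.
  by rewrite tP rmorphM/= linear_form_comp WE divff// scale1r subrr linear_form0 mul0r.
rewrite rmorph_prod => /eqP; rewrite prodf_seq_eq0 => /hasP[v vt] /=.
rewrite linear_form_comp linear_form_eq0 WE subr_eq0 => /eqP vE.
by exists v => //; exists (v 0 p / u 0 p).
Qed.
End LinearForms.

Section Height.
Variable R : realType.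
Local Notation C := (R[i]).

Lemma hermitian_norm_ge0 n (v : 'rV[C]_n) : 0 <= hermitian_norm v.
Proof. exact: sqrtr_ge0. Qed.

Lemma hermitian_normZ n c (v : 'rV[C]_n) :
  hermitian_norm (c *: v) = Normc.normc c * hermitian_norm v.
Proof.
rewrite /hermitian_norm.
under eq_bigr do rewrite mxE Normc.normcM exprMn.
rewrite -mulr_sumr sqrtrM ?sqr_ge0// sqrtr_sqr ger0_norm//.
by case: c => a b; exact: sqrtr_ge0.
Qed.

(** Unique factorization by induction: the head of [s] divides the product over [t], so it is
    proportional to a member of [t], and both cancel. The scalar [k] collects the factors of
    proportionality. *)
Lemma prod_hermitian_norm_unique n (s t : seq 'rV[C]_n) (k : C) :
  size s = size t -> all (fun v => v != 0) s -> 
  \prod_(v <- s) linear_form v = k *: \prod_(v <- t) linear_form v ->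
  \prod_(v <- s) hermitian_norm v = Normc.normc k * \prod_(v <- t) hermitian_norm v.
Proof.
elim: s t k => [|u s IH] t k.
  case: t => // _ _; rewrite !big_nil => /(congr1 (meval (fun=> 0))).
  by rewrite mevalZ !meval1 mulr1 => <-; rewrite Normc.normc1 mulr1.
move=> st /= /andP[u0 s0] sP.
have k0 : k != 0.
  apply: contra_eq_neq sP => ->; rewrite scale0r prodf_seq_neq0 /=.
  apply/andP; split; first by rewrite linear_form_eq0.
  by apply/allP => v vs; rewrite /= linear_form_eq0; exact: (allP s0).
have [|v vt [c vE]] := @linear_form_dvd_prod _ _ u t (k^-1 *: \prod_(v <- s) linear_form v) u0.
  rewrite -scalerAr -[in RHS](big_cons _ _ u s xpredT (@linear_form _ n)) sP.
  by rewrite scalerA mulVf// scale1r.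
move: sP; rewrite big_cons (perm_big _ (perm_to_rem vt)) big_cons /= {1}vE.
rewrite linear_formZ -scalerAl scalerA scalerAr => sP.
have := @mulfI _ (linear_form u); rewrite linear_form_eq0 => /(_ u0 _ _ sP) {}sP.
rewrite !big_cons (perm_big _ (perm_to_rem vt)) big_cons /=.
rewrite (IH _ _ _ s0 sP); last by rewrite size_rem// -st.
by rewrite vE hermitian_normZ Normc.normcM; ring.
Qed.

Lemma heightE n d (F : {mpoly R[n]}) (L : 'I_d -> 'rV[C]_n) :
  is_factorization F L -> height d F = \prod_i hermitian_norm (L i).
Proof.
move=> FL; rewrite /height; case: xgetP => [_ -> [L' [FL' ->]]|/(_ (\prod_i hermitian_norm (L i)))].
  have bigE (T : Type) (idx : T) op (M : 'I_d -> 'rV[C]_n) G :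
      \big[op/idx]_i G (M i) = \big[op/idx]_(v <- [seq M i | i <- index_enum 'I_d]) G v.
    by rewrite big_map.
  rewrite !(bigE _ _ _ _ (@hermitian_norm _ _)).
  set s := map L' _; set t := map L _.
  have -> : \prod_(v <- s) hermitian_norm v = Normc.normc (1 : C) * \prod_(v <- t) hermitian_norm v.
    apply: prod_hermitian_norm_unique.
    - by rewrite !size_map.
    - by apply/allP => v /mapP[i _ ->]; exact: FL'.1.
    - by rewrite scale1r -!bigE -[LHS]FL'.2 -[RHS]FL.2.
  by rewrite Normc.normc1 mul1r.
by case; exists L.
Qed.

Lemma factorization_comp n d (F : {mpoly R[n]}) (L : 'I_d -> 'rV[C]_n) (T : 'M[R]_n) :
  T \in unitmx -> is_factorization F L ->
  is_factorization (form_comp F T) (fun i => L i *m map_mx (real_complex R) T).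
Proof.
move=> uT [L0 FL]; split.
  move=> i; rewrite -(mul0mx _ (map_mx (real_complex R) T)).
  by rewrite (inj_eq (can_inj (mulmxK _))) ?L0// map_unitmx.
rewrite /form_comp map_mpoly_comp; last exact: fmorph_inj.
rewrite [X in comp_mpoly _ X]FL rmorph_prod; apply: eq_bigr => i _ /=.
rewrite -[RHS]linear_form_comp; set t1 := [tuple of _]; set t2 := [tuple linear_form _ | i < n].
suff -> : t1 = t2 by [].
apply: eq_from_tnth => j; rewrite tnth_map !tnth_mktuple /linear_form rmorph_sum.
by apply: eq_bigr => k _; rewrite /= map_mpolyZ map_mpolyX !mxE.
Qed.

Lemma factorization_meval n d (F : {mpoly R[n]}) (L : 'I_d -> 'rV[C]_n) (x : 'I_n -> R) :
  is_factorization F L ->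
  (meval x F)%:C%C = \prod_i \sum_j L i 0 j * (x j)%:C%C.
Proof.
move=> [_ FL].
have -> : (meval x F)%:C%C = meval (fun j => (x j)%:C%C) (map_mpoly (real_complex R) F).
  rewrite mevalE /map_mpoly /mmap !raddf_sum; apply: eq_bigr => m _ /=.
  rewrite mmap1_id mul_mpolyC mevalZ mevalX [LHS](rmorphM (real_complex R)).
  by rewrite rmorph_prod; congr (_ * _); apply: eq_bigr => i _; rewrite rmorphXn.
rewrite FL rmorph_prod; apply: eq_bigr => i _ /=.
rewrite /linear_form raddf_sum; apply: eq_bigr => j _ /=.
by rewrite mevalZ mevalXU.
Qed.

End Height.

(** * Integer points *)

Section Lattice.
Variable R : realType.

(** The vectors are found one at a time. Minkowski's theorem is applied to a box that is thin in all
    directions but one, transversal to the images of the vectors already found; a new vector in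
    their span would have an image shorter than [lam]. *)
Lemma independent_lattice_vectors n (S : 'M[R]_n) (lam : R) :
  (0 < n)%N -> `|\det S| = 1 -> 0 < lam ->
  (forall z : 'rV[int]_n, z != 0 ->
     lam <= \sum_i `|\sum_j S i j * (z 0 j)%:~R|) ->
  exists B : 'M[int]_n, \det (map_mx intr B : 'M[R]_n) != 0 /\
    forall k, \sum_i `|\sum_j S i j * (B k j)%:~R| <=
       5 ^+ n * (4 * n%:R / lam) ^+ (n - 1) + lam.
Proof.
move=> n0 dS lam0 Slam; set rho := _ + lam.
have uS : S \in unitmx by rewrite unitmxE unitfE -normr_gt0 dS.
suff H k : (k <= n)%N -> exists B : 'M[int]_(k, n),
    row_free (map_mx intr B : 'M[R]_(k, n)) /\
    forall k, \sum_i `|\sum_j S i j * (B k j)%:~R| <= rho.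
  have [B [fB HB]] := H n (leqnn n); exists B; split => //.
  by rewrite -unitfE -unitmxE -row_free_unit.
elim: k => [|k IH] kn.
  exists 0; split; last by case.
  by rewrite /row_free -leqn0 rank_leq_row.
have [B [fB HB]] := IH (ltnW kn).
pose M := (map_mx intr B : 'M[R]_(k, n)) *m S^T.
(* A direction orthogonal to the images under [S] of the [k] vectors already found. *)
have [u u0 Mu] : exists2 u : 'cV[R]_n, u != 0 & M *m u = 0.
  have : kermx M^T != 0.
    rewrite -mxrank_eq0 mxrank_ker -lt0n subn_gt0 mxrank_tr.
    exact: leq_ltn_trans (rank_leq_row _) kn.
  move=> /rowV0Pn[v /sub_kermxP vM v0]; exists v^T; first by rewrite trmx_eq0.
  by rewrite -[M]trmxK -trmx_mul vM trmx0.
have [p up umax] : exists2 p, 0 < `|u p 0| & forall i, `|u i 0| <= `|u p 0|.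
  have /existsP[q uq] : [exists q, u q 0 != 0].
    apply: contraT; rewrite negb_exists => /forallP uz; case/eqP: u0.
    by apply/matrixP => i j; rewrite ord1 mxE; exact/eqP/negbNE.
  case: (@arg_maxP _ _ _ q xpredT (fun i => `|u i 0|) isT) => p _ pm; exists p => [|i].
    by apply: lt_le_trans (pm q isT); rewrite normr_gt0.
  exact: pm.
have u00 : u p 0 != 0 by rewrite -normr_gt0.
(* With largest coordinate 1, at [p], the vector [w] determines the [p]-th coordinate of a point
   from its product with [w] and the other coordinates, without loss. *)
pose w : 'rV[R]_n := \row_j (u j 0 / u p 0).
have w1 j : `|w 0 j| <= 1.
  by rewrite mxE normrM normfV ler_pdivrMr// mul1r.
have wp : w 0 p = 1 by rewrite mxE divff.
pose W : 'M[R]_n := \matrix_i (if i == p then w else row i 1%:M).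
have dW : \det W = 1.
  by rewrite det_repl_row ?unitmx1// invmx1 mulmx1 det1 mulr1.
pose l' := lam / (4 * n%:R).
have nR : 0 < n%:R :> R by rewrite ltr0n.
have l'0 : 0 < l' by rewrite divr_gt0// mulr_gt0.
pose h := 5 ^+ n * (4 * n%:R / lam) ^+ (n - 1).
have h0 : 0 < h by rewrite mulr_gt0// exprn_gt0// divr_gt0// mulr_gt0.
(* The product of these bounds is [5 ^+ n], which exceeds the [4 ^+ n] asked for by
   [weak_minkowski]. *)
pose c i := if i == p then h else l'.
have cp : \prod_i c i = 5 ^+ n.
  rewrite (bigD1 p)//= /c eqxx.
  rewrite (eq_bigr (fun=> l')) => [|i ip]; last by rewrite (negPf ip).
  rewrite prodr_const cardC1 card_ord -subn1 /h -[RHS]mulr1.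
  rewrite -[LHS]mulrA -exprMn /l'; congr (_ * _).
  have -> : 4 * n%:R / lam * (lam / (4 * n%:R)) = 1 :> R.
    by field; rewrite gt_eqF//= gt_eqF// ltr0n.
  exact: expr1n.
have [|i||z [z0 zc]] := @weak_minkowski R n (W *m S) c.
- by rewrite unitmxE det_mulmx dW mul1r -unitmxE.
- by rewrite /c; case: ifP.
- rewrite det_mulmx dW mul1r dS mulr1 cp ltrXn2r ?ltr_nat//.
  by rewrite -lt0n.
pose y i := \sum_j S i j * (z 0 j)%:~R.
have WSE i : \sum_j (W *m S) i j * (z 0 j)%:~R = \sum_k W i k * y k.
  under eq_bigr do rewrite mxE mulr_suml.
  rewrite exchange_big; apply: eq_bigr => q _ /=; rewrite mulr_sumr.
  by apply: eq_bigr => j _; rewrite mulrA.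
have yi i : i != p -> `|y i| <= l'.
  move=> ip; have := zc i; rewrite WSE /c (negPf ip); congr (`|_| <= _).
  rewrite (bigD1 i)//= big1 => [|q qi]; rewrite mxE (negPf ip) !mxE.
    by rewrite eqxx mul1r addr0.
  by rewrite eq_sym (negPf qi) mul0r.
have yw : `|\sum_k w 0 k * y k| <= h.
  have := zc p; rewrite WSE /c eqxx; congr (`|_| <= _).
  by apply: eq_bigr => q _; rewrite mxE eqxx.
have sy : \sum_(i | i != p) `|y i| <= lam / 4.
  apply: (@le_trans _ _ (\sum_(i < n | i != p) l')); first exact: ler_sum.
  rewrite sumr_const cardC1 card_ord -[_ *+ n.-1]mulr_natl.
  have : n.-1%:R <= n%:R :> R by rewrite ler_nat leq_pred.
  rewrite -(ler_pM2r l'0) => /le_trans; apply.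
  by rewrite /l' le_eqVlt; apply/orP; left; apply/eqP; field; rewrite gt_eqF.
have yp : `|y p| <= `|\sum_k w 0 k * y k| + lam / 4.
  have -> : y p = \sum_k w 0 k * y k - \sum_(i | i != p) w 0 i * y i.
    by rewrite [X in X - _](bigD1 p)//= wp mul1r addrK.
  apply: le_trans (ler_normB _ _) _; rewrite lerD2l; apply: le_trans sy.
  apply: le_trans (ler_norm_sum _ _ _) _; apply: ler_sum => i _.
  by rewrite normrM ler_piMl.
have ysum : \sum_i `|y i| <= `|\sum_k w 0 k * y k| + lam / 2.
  by rewrite (bigD1 p)//=; move: sy yp; lra.
have Ed j q : (col_mx z B : 'M[int]_(1 + k, n)) (lift ord0 j) q = B j q.
  by rewrite -(rshift1 j) col_mxEd.
have Eu q : (col_mx z B : 'M[int]_(1 + k, n)) ord0 q = z 0 q.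
  by rewrite mxE; case: splitP => [j _|//]; rewrite ord1.
exists (col_mx z B : 'M[int]_(1 + k, n)); split; last first.
  move=> i; case: (unliftP ord0 i) => [j ->|->].
    by under eq_bigr do under eq_bigr do rewrite Ed; exact: HB.
  under eq_bigr do under eq_bigr do rewrite Eu.
  by rewrite /rho -/h; move: ysum yw; rewrite /y; lra.
(* If [z] were dependent, its image would be orthogonal to [w], hence of length at most
   [lam / 2]. *)
have zB : ~~ ((map_mx intr z : 'rV[R]_n) <= map_mx intr B)%MS.
  apply/negP => /submxP[D zD].
  have : (map_mx intr z : 'rV[R]_n) *m S^T *m u = 0.
    by rewrite zD -!mulmxA [X in D *m X]mulmxA Mu mulmx0.
  move=> /matrixP/(_ 0 0); rewrite !mxE.
  have -> : \sum_j ((map_mx intr z : 'rV[R]_n) *m S^T) 0 j * u j 0 =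
      u p 0 * \sum_k w 0 k * y k.
    rewrite mulr_sumr; apply: eq_bigr => j _; rewrite !mxE.
    rewrite mulrA mulrCA divff// mulr1 mulrC; congr (_ * _).
    by apply: eq_bigr => k' _; rewrite !mxE mulrC.
  move/eqP; rewrite mulf_eq0 (negPf u00) /= => /eqP w0.
  have := Slam z z0; move: ysum; rewrite w0 normr0 add0r => h1 h2.
  by have := le_trans h2 h1; lra.
rewrite /row_free eqn_leq rank_leq_row /=.
suff : (k < \rank (col_mx (map_mx intr z) (map_mx intr B) : 'M[R]_(1 + k, n)))%N.
  by rewrite -map_col_mx.
rewrite -[X in (X < _)%N](eqP fB); apply: rank_ltmx.
have := submx_refl (col_mx (map_mx intr z) (map_mx intr B) : 'M[R]_(1 + k, n)).
by rewrite col_mx_sub => /andP[_ h1]; rewrite /ltmx h1 col_mx_sub negb_and zB.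
Qed.
End Lattice.

(** * A Liouville inequality *)

Section IntegerEigenvalues.
Variable R : realType.
Local Notation C := (R[i]).
Local Notation nc := (@Normc.normc R).

Lemma normc_ge0 (z : C) : 0 <= nc z.
Proof. by case: z => a b; exact: sqrtr_ge0. Qed.

Lemma normc_prod (I : Type) (r : seq I) (F : I -> C) :
  nc (\prod_(i <- r) F i) = \prod_(i <- r) nc (F i).
Proof. exact: (big_morph _ (@Normc.normcM R) (@Normc.normc1 R)). Qed.

Lemma normc_sum_le (I : Type) (r : seq I) (F : I -> C) :
  nc (\sum_(i <- r) F i) <= \sum_(i <- r) nc (F i).
Proof.
elim: r => [|i r IH]; first by rewrite !big_nil Normc.normc0.
by rewrite !big_cons; apply: le_trans (le_normcD _ _) _; rewrite lerD2l.
Qed.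

Lemma normc_eq0 (z : C) : (nc z == 0) = (z == 0).
Proof.
by apply/eqP/eqP => [|->]; [exact: Normc.eq0_normc|exact: Normc.normc0].
Qed.

Lemma normc_real (x : R) : nc x%:C%C = `|x|.
Proof. by rewrite /Normc.normc /= expr0n /= addr0 sqrtr_sqr. Qed.

Lemma normc_int (k : int) : nc k%:~R = `|k%:~R|.
Proof. by rewrite -(rmorph_int (real_complex R)) normc_real. Qed.

(* [b] is an algebraic integer all of whose conjugates are at most [B] in
   absolute value; fixing the eigenvector [v] makes sums and products of such
   numbers correspond to sums and products of matrices. *)
Definition int_eigen N (v : 'rV[C]_N) (B : R) (b : C) :=
  exists A : 'M[int]_N, v *m map_mx intr A = b *: v /\
    forall j, \sum_i `|(A i j)%:~R| <= B.

Section Closure.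
Variables (N : nat) (v : 'rV[C]_N).
Local Notation ie := (int_eigen v).

(** The bound concerns the maximal absolute column sum, which is a submultiplicative norm. *)
Lemma int_eigenM B1 B2 b1 b2 : 0 <= B1 ->
  ie B1 b1 -> ie B2 b2 -> ie (B1 * B2) (b1 * b2).
Proof.
move=> B10 [A1 [v1 c1]] [A2 [v2 c2]]; exists (A1 *m A2); split.
  by rewrite map_mxM mulmxA v1 -scalemxAl v2 scalerA.
move=> j; apply: (@le_trans _ _ (\sum_k `|(A2 k j)%:~R| * B1)).
  under eq_bigr do rewrite mxE rmorph_sum.
  apply: (@le_trans _ _ (\sum_i \sum_k `|(A1 i k)%:~R| * `|(A2 k j)%:~R|)).
    apply: ler_sum => i _; apply: le_trans (ler_norm_sum _ _ _) _.
    by apply: ler_sum => k _; rewrite rmorphM normrM.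
  rewrite exchange_big; apply: ler_sum => k _ /=.
  by rewrite -mulr_suml mulrC ler_wpM2l.
by rewrite -mulr_suml mulrC ler_wpM2l.
Qed.

Lemma int_eigenD B1 B2 b1 b2 : ie B1 b1 -> ie B2 b2 -> ie (B1 + B2) (b1 + b2).
Proof.
move=> [A1 [v1 c1]] [A2 [v2 c2]]; exists (A1 + A2); split.
  by rewrite map_mxD mulmxDr v1 v2 scalerDl.
move=> j; apply: le_trans (lerD (c1 j) (c2 j)); rewrite -big_split /=.
by apply: ler_sum => i _; rewrite mxE rmorphD ler_normD.
Qed.

Lemma int_eigenN B b : ie B b -> ie B (- b).
Proof.
move=> [A [vA cA]]; exists (- A); split.
  by rewrite map_mxN mulmxN vA scaleNr.
by move=> j; apply: le_trans (cA j); apply: ler_sum => i _; rewrite mxE rmorphN normrN.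
Qed.

Lemma int_eigen1 : ie 1 1.
Proof.
exists 1%:M; split; first by rewrite map_mx1 mulmx1 scale1r.
move=> j; rewrite (bigD1 j)//= big1 => [|i ij]; rewrite mxE.
  by rewrite eqxx normr1 addr0.
by rewrite (negPf ij) normr0.
Qed.

Lemma int_eigen0 : ie 0 0.
Proof.
exists 0; split; first by rewrite map_mx0 mulmx0 scale0r.
by move=> j; rewrite big1// => i _; rewrite mxE normr0.
Qed.

Lemma int_eigen_sum (I : finType) (B : R) (F : I -> C) :
  (forall i, ie B (F i)) -> ie (#|I|%:R * B) (\sum_i F i).
Proof.
move=> BF; rewrite cardT -sum1_size natr_sum mulr_suml big_enum /=.
rewrite big_mkcond /=.
elim/big_rec2: _ => [|i b c _ IH]; first exact: int_eigen0.
by rewrite mul1r; exact: int_eigenD.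
Qed.

Lemma int_eigen_prod n (B : R) (F : 'I_n -> C) : 0 <= B ->
  (forall i, ie B (F i)) -> ie (B ^+ n) (\prod_i F i).
Proof.
move=> B0; elim: n F => [|n IH] F BF; first by rewrite big_ord0; exact: int_eigen1.
by rewrite big_ord_recl exprS; apply: int_eigenM => //; exact: IH.
Qed.

Lemma int_eigen_det n (B : R) (M : 'M[C]_n) : 0 <= B ->
  (forall i j, ie B (M i j)) -> ie (#|perm_of 'I_n|%:R * B ^+ n) (\det M).
Proof.
move=> B0 BM; rewrite /determinant.
apply: int_eigen_sum => s; case: (odd_perm s); rewrite ?expr1 ?expr0 ?mulN1r ?mul1r.
  by apply: int_eigenN; exact: int_eigen_prod.
exact: int_eigen_prod.
Qed.

(** Compare both sides of the eigenvector equation at a coordinate where [v] is largest. *)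
Lemma int_eigen_upper B b : v != 0 -> ie B b -> nc b <= B.
Proof.
move=> /rV0Pn[p vp] [A [vA cA]].
have [q _ qm] := @arg_maxP _ _ _ p xpredT (fun i => nc (v 0 i)) isT.
have vq : 0 < nc (v 0 q).
  by apply: lt_le_trans (qm p isT); rewrite lt_def normc_ge0 normc_eq0 vp.
rewrite -(ler_pM2r vq) -Normc.normcM.
have -> : b * v 0 q = \sum_i v 0 i * (A i q)%:~R.
  move/rowP: vA => /(_ q); rewrite !mxE => <-.
  by apply: eq_bigr => i _; rewrite mxE.
apply: le_trans (normc_sum_le _ _) _.
apply: (@le_trans _ _ (\sum_i `|(A i q)%:~R| * nc (v 0 q))).
  apply: ler_sum => i _; rewrite Normc.normcM normc_int mulrC ler_wpM2l//.
  exact: qm.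
by rewrite -mulr_suml ler_wpM2r// normc_ge0.
Qed.

End Closure.

(* The product of the nonzero roots of the characteristic polynomial is, up to
   sign, its lowest nonzero coefficient, a nonzero integer. *)
Theorem int_eigen_lower N (v : 'rV[C]_N) B b : v != 0 -> 1 <= B ->
  int_eigen v B b -> b != 0 -> 1 <= nc b * B ^+ N.
Proof.
move=> v0 B1 [A [vA cA]] b0.
pose chi := char_poly (map_mx intr A : 'M[C]_N).
have [r] := closed_field_poly_normal chi.
have /monicP -> : chi \is monic by exact: char_poly_monic.
rewrite scale1r => chiE.
have rB z : z \in r -> nc z <= B.
  move=> zr; have : root chi z by rewrite chiE root_prod_XsubC.
  rewrite -eigenvalue_root_char => /eigenvalueP[w wA w0].
  by apply: (@int_eigen_upper _ w) => //; exists A.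
have br : b \in r.
  rewrite -root_prod_XsubC -chiE -eigenvalue_root_char.
  by apply/eigenvalueP; exists v.
pose s := [seq z <- r | z != 0].
have bs : b \in s by rewrite mem_filter b0.
have chiE' : chi = 'X^(count (pred1 0) r) * \prod_(z <- s) ('X - z%:P).
  rewrite chiE /s; elim: (r) => [|z t IH]; first by rewrite !big_nil mulr1.
  rewrite big_cons IH /=; case: eqP => [->|_] /=.
    by rewrite subr0 add1n exprS mulrA.
  by rewrite big_cons add0n mulrCA.
have coefE : chi`_(count (pred1 0) r) = \prod_(z <- s) - z.
  rewrite chiE' coefXnM ltnn subnn -horner_coef0 horner_prod.
  by apply: eq_bigr => z _; rewrite hornerXsubC sub0r.
have sB : (size s <= N.+1.-1)%N.
  rewrite size_filter; apply: leq_trans (count_size _ _) _.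
  by rewrite -(size_char_poly (map_mx intr A : 'M[C]_N)) -/chi chiE size_prod_XsubC.
have prod1 : 1 <= nc (\prod_(z <- s) - z).
  have : \prod_(z <- s) - z != 0.
    by rewrite prodf_seq_neq0; apply/allP => z; rewrite mem_filter oppr_eq0 => /andP[].
  rewrite -coefE /chi -map_char_poly coef_map /= intr_eq0 normc_int => k0.
  by rewrite -intr_norm ler1z -gtz0_ge1 normr_gt0.
(* Apart from [b] there remain at most [N] nonzero roots, each of absolute value at most [B]. *)
apply: (le_trans prod1); rewrite (perm_big _ (perm_to_rem bs)) big_cons Normc.normcM normcN.
rewrite ler_wpM2l ?normc_ge0// normc_prod.
have remB : forall z, z \in rem b s -> nc z <= B.
  by move=> z /mem_rem; rewrite mem_filter => /andP[_ /rB].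
have remN : (size (rem b s) <= N)%N.
  by apply: leq_trans sB; rewrite size_rem// leq_pred.
apply: (@le_trans _ _ (B ^+ size (rem b s))); last exact: ler_weXn2l.
elim: (rem b s) remB => [|z t IH] tB; first by rewrite big_nil.
rewrite big_cons exprS normcN ler_pM//; first exact: normc_ge0.
- by rewrite prodr_ge0// => y _; exact: normc_ge0.
- by apply: tB; rewrite mem_head.
- by apply: IH => y yt; apply: tB; rewrite inE yt orbT.
Qed.

End IntegerEigenvalues.

Section CommonEigenvector.
Variable R : realType.
Local Notation C := (R[i]).
Local Notation nc := (@Normc.normc R).

(* The common eigenvector consists of the monomials in the [g t] with exponents
   at most [d]. *)
Lemma int_eigen_family (T : finType) d (g : T -> C) (a : T -> 'I_d.+1 -> 'I_d.+1 -> int) B :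
  (forall t (m : 'I_d.+1), g t ^+ m.+1 = \sum_k (a t m k)%:~R * g t ^+ k) ->
  (forall t m, \sum_k `|(a t m k)%:~R : R| <= B) ->
  exists v : 'rV[C]_#|{ffun T -> 'I_d.+1}|, v != 0 /\ forall t, int_eigen v B (g t).
Proof.
move=> ga aB; pose J := {ffun T -> 'I_d.+1}.
pose mon (e : J) := \prod_t g t ^+ e t.
pose ev (i : 'I_#|{ffun T -> 'I_d.+1}|) : J := enum_val i.
exists (\row_j mon (ev j)); split.
  apply/rV0Pn; exists (enum_rank [ffun=> ord0]); rewrite mxE /ev enum_rankK /mon.
  by rewrite big1 ?oner_neq0// => t _; rewrite ffunE expr0.
move=> t.
(* Multiplying a monomial by [g t] raises one exponent; the relation for [g t] expresses the result
   through monomials that differ from the original in this exponent only. *)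
pose upd (e : J) k : J := [ffun s => if s == t then k else e s].
exists (\matrix_(i, j) \sum_k a t (ev j t) k *
   (ev i == upd (ev j) k)%:R); split.
  apply/rowP => j; rewrite !mxE; set e := ev j.
  have monE : g t * mon e = \sum_k (a t (e t) k)%:~R * mon (upd e k).
    rewrite /mon (bigD1 t)//= mulrA -exprS ga mulr_suml; apply: eq_bigr => k _.
    rewrite [in RHS](bigD1 t)//= ffunE eqxx mulrA; congr (_ * _).
    by apply: eq_bigr => s st; rewrite ffunE (negPf st).
  rewrite monE.
  under eq_bigr do rewrite !mxE rmorph_sum mulr_sumr.
  rewrite exchange_big /=; apply: eq_bigr => k _.
  rewrite (bigD1 (enum_rank (upd e k)))//= /ev enum_rankK eqxx mulr1 mulrC big1 ?addr0//.
  move=> i ik; case: eqP => [eik|]; last by rewrite mulr0 mulr0.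
  by move: ik; rewrite -eik enum_valK eqxx.
move=> j; set e := ev j; apply: le_trans (aB t (e t)).
under eq_bigr do rewrite !mxE rmorph_sum.
apply: (@le_trans _ _ (\sum_(i < #|{: J}|) \sum_k `|(a t (e t) k)%:~R : R| * (ev i == upd e k)%:R)).
  apply: ler_sum => i _; apply: le_trans (ler_norm_sum _ _ _) _.
  apply: ler_sum => k _; rewrite rmorphM normrM ler_wpM2l//.
  by case: (_ == _); rewrite ?normr1 ?normr0.
rewrite exchange_big /=; apply: ler_sum => k _; rewrite -mulr_sumr.
rewrite (bigD1 (enum_rank (upd e k)))//= /ev enum_rankK eqxx big1 ?addr0 ?mulr1//.
move=> i ik; case: eqP => [eik|] //.
by move: ik; rewrite -eik enum_valK eqxx.
Qed.

(** Up to exponent [d] a power of [g t] is its own expansion, with a single coefficient 1; only the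
    power [d.+1] uses the monic equation. *)
Lemma algebraic_integers_eigen (T : finType) d (g : T -> C) (c : T -> 'I_d.+1 -> int) B :
  1 <= B ->
  (forall t, g t ^+ d.+1 = \sum_k (c t k)%:~R * g t ^+ k) ->
  (forall t, \sum_k `|(c t k)%:~R : R| <= B) ->
  exists v : 'rV[C]_#|{ffun T -> 'I_d.+1}|, v != 0 /\ forall t, int_eigen v B (g t).
Proof.
move=> B1 gc cB.
pose a t (m k : 'I_d.+1) : int := if (m < d)%N then (k == m.+1 :> nat)%:R else c t k.
apply: (@int_eigen_family T d g a B) => t m; rewrite /a; case: ltnP => md.
- rewrite (bigD1 (Ordinal (md : m.+1 < d.+1)%N))//= eqxx mul1r big1 ?addr0// => k km.
  have /negPf -> : (k : nat) != m.+1 by apply: contra km => /eqP h; apply/eqP/val_inj.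
  by rewrite ?mul0r ?normr0.
- have -> : m = ord_max by apply/val_inj/eqP; rewrite eqn_leq -ltnS ltn_ord.
  exact: gc.
- rewrite (bigD1 (Ordinal (md : m.+1 < d.+1)%N))//= eqxx normr1 big1 ?addr0// => k km.
  have /negPf -> : (k : nat) != m.+1 by apply: contra km => /eqP h; apply/eqP/val_inj.
  by rewrite ?mul0r ?normr0.
- exact: cB.
Qed.

Lemma coef_prod_linear_le (I : Type) (s : seq I) (u w : I -> C) i :
  nc (\prod_(j <- s) (u j *: 'X - (w j)%:P))`_i <= \prod_(j <- s) (nc (u j) + nc (w j)).
Proof.
elim: s i => [|j s IH] i.
  rewrite !big_nil coef1; case: eqP => _; rewrite ?mulr1n ?mulr0n ?Normc.normc1//.
  by rewrite Normc.normc0.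
rewrite !big_cons mulrBl coefB -scalerAl coefZ coefXM coefCM mulrDl.
apply: le_trans (le_normcD _ _) _; rewrite normcN !Normc.normcM.
apply: lerD; apply: ler_wpM2l; rewrite ?normc_ge0//.
case: eqP => // _; rewrite Normc.normc0 prodr_ge0// => k _.
by rewrite addr_ge0 ?normc_ge0.
Qed.

Lemma prod_linear_scaled d (u w : 'I_d.+1 -> C) : (forall j, u j != 0) ->
  \prod_j (u j *: 'X - (w j)%:P) =
  (\prod_j u j) *: \prod_(j < d.+1) ('X - (w j / u j)%:P).
Proof.
move=> u0; rewrite -scaler_prod; apply: eq_bigr => i _.
by rewrite scalerBr -[u i *: _%:P]mul_polyC -polyCM [u i * _]mulrC divfK.
Qed.

Lemma size_prod_XsubC_ord d (r : 'I_d -> C) : size (\prod_j ('X - (r j)%:P)) = d.+1.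
Proof. by rewrite size_prod_XsubC /index_enum -enumT size_enum_ord. Qed.

Lemma lead_coef_prod_linear d (u w : 'I_d.+1 -> C) (P : {poly int}) :
  map_poly intr P = \prod_j (u j *: 'X - (w j)%:P) -> (forall j, u j != 0) ->
  (P`_d.+1)%:~R = \prod_j u j.
Proof.
move=> PE u0; rewrite -(coef_map intr) PE prod_linear_scaled// coefZ.
have /monicP := monic_prod_XsubC (index_enum 'I_d.+1) xpredT (fun j => w j / u j).
by rewrite /lead_coef size_prod_XsubC_ord => ->; rewrite mulr1.
Qed.

(* [P] is a multiple of the polynomial with roots [w j / u j]; scaling by its
   leading coefficient makes the roots integral. *)
Lemma scaled_root_relation d (u w : 'I_d.+1 -> C) (P : {poly int}) j :
  map_poly intr P = \prod_j (u j *: 'X - (w j)%:P) ->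
  (forall j, u j != 0) -> 
  exists c : 'I_d.+1 -> int,
    ((P`_d.+1)%:~R * (w j / u j)) ^+ d.+1 =
    \sum_k (c k)%:~R * ((P`_d.+1)%:~R * (w j / u j)) ^+ k /\
    \sum_k `|(c k)%:~R : R| <= d.+1%:R * (\prod_j (nc (u j) + nc (w j))) ^+ d.+1.
Proof.
move=> PE u0; set a := P`_d.+1; set al := w j / u j; set Q' := \prod_j _.
have PiQ i : `|(P`_i)%:~R : R| <= Q'.
  rewrite -normc_int -[_%:~R]/(intmul 1 _) -(coef_map intr) PE.
  exact: coef_prod_linear_le.
have aE : a%:~R = \prod_j u j by exact: lead_coef_prod_linear PE u0.
have a1 : 1 <= `|a%:~R : R|.
  have a0 : a != 0 by rewrite -(intr_eq0 C) aE; apply/prodf_neq0.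
  by rewrite -intr_norm ler1z -gtz0_ge1 normr_gt0.
have Q1 : 1 <= Q' by apply: le_trans a1 (PiQ _).
(* Multiplying the equation [P.[al] = 0] by [a ^+ d] makes it a monic one for [a * al]. *)
exists (fun k => - P`_k * a ^+ (d - k)); split.
  have : (map_poly intr P).[al] = 0.
    rewrite PE prod_linear_scaled// hornerZ horner_prod [X in _ * X](bigD1 j)//= !hornerE /al subrr.
    by rewrite /= ?mulr0 ?mul0r ?mulr0.
  have sP : (size (map_poly intr P : {poly C}) <= d.+2)%N.
    rewrite PE prod_linear_scaled//; apply: leq_trans (size_scale_leq _ _) _.
    by rewrite size_prod_XsubC_ord.
  rewrite (horner_coef_wide _ sP) big_ord_recr /= coef_map /= -/a => /eqP.
  rewrite addrC addr_eq0 => /eqP ha.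
  rewrite exprMn exprS -mulrA [_ * (_ * al ^+ _)]mulrCA ha mulrN mulr_sumr -sumrN.
  apply: eq_bigr => k _; rewrite coef_map /= exprMn rmorphM rmorphN rmorphXn /=.
  have kd : (k <= d)%N by rewrite -ltnS.
  rewrite !mulNr -{1}(subnK kd) exprD /al !exprMn; congr (- _).
  by set x := (u j)^-1 ^+ k; ring.
apply: (@le_trans _ _ (\sum_(k < d.+1) Q' ^+ d.+1)); last first.
  by rewrite sumr_const card_ord -[leLHS]mulr_natl.
apply: ler_sum => k _; rewrite rmorphM rmorphN rmorphXn normrM normrN normrX.
have kd : (k <= d)%N by rewrite -ltnS.
apply: (@le_trans _ _ (Q' * Q' ^+ (d - k))).
  apply: ler_pM; [exact: normr_ge0|exact: exprn_ge0|exact: PiQ|].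
  by rewrite lerXn2r ?nnegrE//; [exact: le_trans ler01 Q1|exact: PiQ].
by rewrite -exprS; apply: ler_weXn2l => //; rewrite ltnS leq_subr.
Qed.

End CommonEigenvector.

Section Pencil.
Variable R : realType.
Local Notation C := (R[i]).

Lemma rmorph_meval (S1 S2 : comRingType) (f : {rmorphism S1 -> S2}) n (x : 'I_n -> S1)
    (p : {mpoly S1[n]}) :
  f (meval x p) = meval (f \o x) (map_mpoly f p).
Proof.
rewrite mevalE /map_mpoly /mmap !raddf_sum; apply: eq_bigr => m _ /=.
rewrite mmap1_id mul_mpolyC mevalZ mevalX rmorphM.
by rewrite rmorph_prod; congr (_ * _); apply: eq_bigr => i _; rewrite rmorphXn.
Qed.

(** The polynomial is F(t x - y) in the indeterminate t: its coefficients are integers because those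
    of F are, and it splits along with F. *)
Lemma integral_pencil n d (F : {mpoly int[n]}) (L : 'I_d -> 'rV[C]_n) (x y : 'I_n -> int) :
  is_factorization (map_mpoly intr F : {mpoly R[n]}) L ->
  exists P : {poly int}, map_poly intr P =
    \prod_j ((\sum_i L j 0 i * (x i)%:~R) *: 'X - (\sum_i L j 0 i * (y i)%:~R)%:P).
Proof.
move=> [_ FL]; exists (meval (fun i => x i *: 'X - (y i)%:P) (map_mpoly polyC F)).
rewrite (rmorph_meval (map_poly intr)).
have -> : map_mpoly (map_poly intr) (map_mpoly polyC F) =
    map_mpoly polyC (map_mpoly (real_complex R) (map_mpoly intr F)).
  apply/mpolyP => m; rewrite !mcoeff_map_mpoly /= map_polyC /=.
  by congr (_%:P); exact/esym/(rmorph_int (real_complex R)).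
rewrite FL.
have -> : map_mpoly polyC (\prod_j linear_form (L j)) =
    \prod_j map_mpoly polyC (linear_form (L j)) by exact: rmorph_prod.
rewrite rmorph_prod; apply: eq_bigr => j _.
rewrite /linear_form; pose t i := L j 0 i *: mpolyX C (mnm1 i).
have -> : map_mpoly polyC (\sum_i t i) = \sum_i map_mpoly polyC (t i).
  exact: raddf_sum.
rewrite !raddf_sum /= scaler_suml -big_split /= {}/t.
apply: eq_bigr => i _.
rewrite map_mpolyZ map_mpolyX mevalZ mevalXU /= rmorphB /=.
rewrite linearZ_LR /= map_polyX map_polyC /=.
by rewrite mulrBr mul_polyC scalerA -polyCM.
Qed.

End Pencil.

Section Liouville.
Variable R : realType.
Local Notation C := (R[i]).
Local Notation nc := (@Normc.normc R).

(* [e = true] selects the imaginary part. *)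
Definition real_part n (v : 'rV[C]_n) (e : bool) : 'rV[R]_n :=
  \row_k (if e then complex.Im (v 0 k) else complex.Re (v 0 k)).

Definition real_parts_mx n d (l : 'I_d -> 'rV[C]_n) (I : 'I_n -> 'I_d * bool) : 'M[R]_n :=
  \matrix_i real_part (l (I i).1) (I i).2.

(** The number of monomials, with exponents less than [d], in the [d * n] scaled values of the forms
    at the lattice vectors and in their complex conjugates: the size of the integer matrices of
    [int_eigen]. *)
Definition liouville_size n d := #|{ffun 'I_d * 'I_n * bool -> 'I_d}|.

(** Leibniz's formula for a matrix whose entries are sums or differences of two numbers with bound
    [d%:R * Q ^+ d]. *)
Definition liouville_bound n d (Q : R) : R :=
  #|perm_of 'I_n|%:R * (2 * (d%:R * Q ^+ d)) ^+ n.

Lemma real_part_eval n (v : 'rV[C]_n) (e : bool) (x : 'I_n -> R) :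
  \sum_k real_part v e 0 k * x k =
  (if e then complex.Im (\sum_k v 0 k * (x k)%:C%C) else complex.Re (\sum_k v 0 k * (x k)%:C%C)).
Proof.
by case: e; rewrite raddf_sum; apply: eq_bigr => k _; rewrite mxE;
  case: (v 0 k) => a b /=; ring.
Qed.

(** The forms are normalized to the value 1 at the first row of [B]. Multiplied by the integer [a],
    which is F at that row, their values at the rows of [B] are algebraic integers; so are twice the
    real parts, and the imaginary parts times 2i. Hence the determinants, scaled by [kappa], are
    absolute values of algebraic integers whose conjugates are bounded. *)
Lemma liouville n d (F : {mpoly int[n.+1]}) (L : 'I_d.+1 -> 'rV[C]_n.+1)
    (B : 'M[int]_n.+1) (Q : R) (b := fun j k => \sum_i L j 0 i * (B k i)%:~R)
    (l := fun j => (b j ord0)^-1 *: L j) :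
  is_factorization (map_mpoly intr F : {mpoly R[n.+1]}) L ->
  (forall j, b j ord0 != 0) -> \det (map_mx intr B : 'M[R]_n.+1) != 0 ->
  1 <= Q -> (forall k, \prod_j (nc (b j ord0) + nc (b j k)) <= Q) ->
  exists kappa : R, 0 < kappa /\
    kappa <= (2 * Q) ^+ n.+1 * `|\det (map_mx intr B : 'M[R]_n.+1)| /\
    forall I : 'I_n.+1 -> 'I_d.+1 * bool,
    let D := kappa * `|\det (real_parts_mx l I)| in
    D <= liouville_bound n.+1 d.+1 Q /\
    (D != 0 -> 1 <= D * liouville_bound n.+1 d.+1 Q ^+ liouville_size n.+1 d.+1).
Proof.
move=> FL b0 dB Q1 bQ.
have /choice[P PE] k := integral_pencil (B ord0) (B k) FL.
(* All the pencils start at the same row, so they share their leading coefficient. *)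
have aE k : ((P k)`_d.+1)%:~R = \prod_j b j ord0.
  exact: lead_coef_prod_linear (PE k) b0.
pose a := (P ord0)`_d.+1.
have a0 : a != 0 by rewrite -(intr_eq0 C) aE; apply/prodf_neq0.
have al j k : a%:~R * (b j k / b j ord0) = a%:~R * \sum_i l j 0 i * (B k i)%:~R.
  congr (_ * _); rewrite mulrC mulr_sumr; apply: eq_bigr => i _.
  by rewrite mxE mulrA.
(* The boolean selects the complex conjugate, which satisfies the same integer relations. *)
pose g (t : 'I_d.+1 * 'I_n.+1 * bool) : C :=
  let z := a%:~R * (b t.1.1 t.1.2 / b t.1.1 ord0) in if t.2 then conjc z else z.
set Bd := d.+1%:R * Q ^+ d.+1.
have Bd1 : 1 <= Bd.
  by rewrite -[X in X <= _]mulr1 ler_pM ?ler1n ?exprn_ege1.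
have rel t : exists c : 'I_d.+1 -> int,
    g t ^+ d.+1 = \sum_k (c k)%:~R * g t ^+ k /\ \sum_k `|(c k)%:~R : R| <= Bd.
  have [c [cE cB]] := @scaled_root_relation R d (b^~ ord0) (b^~ t.1.2) _ t.1.1 (PE t.1.2) b0.
  have aP : ((P t.1.2)`_d.+1)%:~R = a%:~R :> C by rewrite !aE.
  exists c; split.
    rewrite /g -aP /=; case: t.2 => //=; rewrite -[in LHS]rmorphXn cE rmorph_sum.
    apply: eq_bigr => k _; rewrite rmorphM rmorphXn; congr (_ * _).
    by rewrite rmorph_int.
  apply: (le_trans cB); rewrite /Bd ler_wpM2l// lerXn2r ?nnegrE//.
    by apply: prodr_ge0 => j _; rewrite addr_ge0 ?normc_ge0.
  exact: le_trans ler01 Q1.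
have [c cP] := choice rel.
have [v [v0 vg]] := algebraic_integers_eigen Bd1 (fun t => (cP t).1) (fun t => (cP t).2).
have aR0 : 0 < `|a%:~R : R| by rewrite normr_gt0 intr_eq0.
(* The factor between the determinant of the real parts and that of [W]: [2 * a] for each row, and
   [\det B] for evaluating at the rows of [B]. *)
exists ((2 * `|a%:~R|) ^+ n.+1 * `|\det (map_mx intr B : 'M[R]_n.+1)|).
split; first by apply: mulr_gt0; [exact/exprn_gt0/mulr_gt0|rewrite normr_gt0].
split.
  rewrite ler_wpM2r// lerXn2r ?nnegrE ?mulr_ge0//; first exact: le_trans ler01 Q1.
  rewrite ler_pM2l// -normc_int aE normc_prod; apply: le_trans (bQ ord0).
  apply: ler_prod => j _; rewrite normc_ge0 lerDl; exact: normc_ge0.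
move=> I D.
pose W : 'M[C]_n.+1 := \matrix_(i, k) (g ((I i).1, k, false) +
   (if (I i).2 then - 1 else 1) * g ((I i).1, k, true)).
have Wie i k : int_eigen v (2 * Bd) (W i k).
  rewrite mxE mulr2n mulrDl !mul1r; apply: int_eigenD; first exact: vg.
  by case: (I i).2; rewrite ?mul1r ?mulN1r; [apply: int_eigenN|]; exact: vg.
have Bd0 : 0 <= 2 * Bd by rewrite mulr_ge0// (le_trans ler01).
have dW := int_eigen_det Bd0 Wie.
have DW : D = nc (\det W).
  have -> : W = diag_mx (\row_i (2 * a%:~R * (if (I i).2 then 'i%C else 1))) *m
      map_mx (real_complex R) (real_parts_mx l I *m (map_mx intr B)^T).
    apply/matrixP => i k; rewrite mul_diag_mx !mxE /g /= al.
    set Z := \sum_q l (I i).1 0 q * _.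
    have -> : \sum_q real_parts_mx l I i q * (map_mx intr B)^T q k =
        if (I i).2 then complex.Im Z else complex.Re Z.
      have -> : Z = \sum_q l (I i).1 0 q * ((B k q)%:~R : R)%:C%C.
        apply: eq_bigr => q _; congr (_ * _).
        by rewrite [RHS](rmorph_int (real_complex R)).
      by rewrite -real_part_eval; apply: eq_bigr => q _; rewrite !mxE.
    have -> : (a%:~R * Z)^*%C = a%:~R * Z^*%C by rewrite rmorphM rmorph_int.
    have conjE (e : bool) : Z + (if e then -1 else 1) * Z^*%C =
        2 * ((if e then 'i%C else 1) * (if e then complex.Im Z else complex.Re Z)%:C%C).
      rewrite [2 * _]mulr_natl mulr2n; case: e; case: Z => x y;
        apply/eqP; rewrite eq_complex /=; apply/andP; split; apply/eqP; ring.
    by rewrite [_ * (a%:~R * _)]mulrCA -mulrDr conjE -!mulrA [RHS]mulrCA.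
  rewrite det_mulmx det_diag det_map_mx Normc.normcM normc_prod normc_real.
  rewrite det_mulmx det_tr normrM /D -mulrA [_ * `|\det (real_parts_mx _ _)|]mulrC.
  congr (_ * _).
  rewrite (eq_bigr (fun=> 2 * `|a%:~R|)) ?prodr_const ?card_ord// => i _.
  rewrite mxE !Normc.normcM normc_int -[2]/(2%:~R) normc_int ger0_norm//.
  case: (I i).2; rewrite ?Normc.normc1 ?mulr1//.
  by rewrite /Normc.normc /= expr0n expr1n add0r sqrtr1 mulr1.
rewrite DW; split.
  exact: int_eigen_upper v0 dW.
rewrite normc_eq0 => dW0; apply: int_eigen_lower v0 _ dW dW0.
rewrite -[X in X <= _]mulr1 ler_pM//.
  by rewrite ler1n; apply/card_gt0P; exists 1%g.
by rewrite exprn_ege1//; lra.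
Qed.

End Liouville.

(** * Stability *)

Section InfiniteVolume.
Variable R : realType.
Local Notation mR := (measurableTypeR R).
Local Notation C := (R[i]).
Local Notation nc := (@Normc.normc R).

Definition eval_form n (v : 'rV[C]_n) (x : 'I_n -> R) : C :=
  \sum_k v 0 k * (x k)%:C%C.

Definition form_body n d (L : 'I_d -> 'rV[C]_n) (K : R) : set (n.-tuple mR) :=
  [set x | \prod_j nc (eval_form (L j) (tnth x)) <= K].

Lemma nc_eval_form n (v : 'rV[C]_n) (x : 'I_n -> R) :
  nc (eval_form v x) = Num.sqrt ((\sum_k real_part v false 0 k * x k) ^+ 2 +
                                 (\sum_k real_part v true 0 k * x k) ^+ 2).
Proof. by rewrite !real_part_eval /eval_form; case: (\sum_k _). Qed.

Lemma measurable_form_body n d (L : 'I_d -> 'rV[C]_n) K :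
  measurable (form_body L K).
Proof.
rewrite (_ : form_body L K = (fun x : n.-tuple mR =>
   \prod_j nc (eval_form (L j) (tnth x))) @^-1` `]-oo, K]).
  rewrite -[X in measurable X]setTI.
  apply: (@measurable_prod _ _ _ _ _ _ (fun j x => nc (eval_form (L j) (tnth x)))) => //.
  move=> j _; under eq_fun do rewrite nc_eval_form.
  apply: measurableT_comp; first exact: continuous_measurable_fun (@sqrt_continuous R).
  by apply: measurable_funD; apply: measurable_funX; exact: measurable_linear_form.
by apply/seteqP; split => x /=; rewrite in_itv.
Qed.

Lemma prod_if n (S : {set 'I_n}) (a b : R) :
  \prod_k (if k \in S then a else b) = a ^+ #|S| * b ^+ #|~: S|.
Proof.
rewrite (bigID (mem S)) /=; congr (_ * _).
  by rewrite (eq_bigr (fun=> a)) ?prodr_const// => k ->.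
rewrite (eq_bigr (fun=> b)) ?prodr_const => [|k /negPf->//].
by congr (_ ^+ _); apply: eq_card => k; rewrite inE.
Qed.

(* The body contains the disjoint boxes with coordinates at most [c / 2 ^ (t i)]
   in [S] and at most [c * 2 ^ (s i)] outside [S], [s] and [t] being the sizes of
   [S] and its complement; all have the same volume. *)
Lemma infinite_volume n d (L Cf : 'I_d -> 'rV[C]_n) (T : 'M[R]_n) (S : {set 'I_n}) (K : R) :
  (0 < d)%N -> T \in unitmx -> (forall j, L j = Cf j *m map_mx (real_complex R) T) ->
  (0 < #|S|)%N -> (0 < #|~: S|)%N -> 0 < K ->
  (d * #|S| <= n * #|[set j | [forall k, (k \in S) || (Cf j 0%R k == 0%R)]]%SET|)%N ->
  lebesgue_tuple R n (form_body L K) = +oo%E.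
Proof.
move=> d0 uT LC S0 S0' K0; set J := [set j | _]%SET => dS.
have [p pS] := card_gt0P S0'.
set s := #|S| in S0 dS *; set t := #|~: S| in S0' *; set r := #|J| in dS.
have st : (s + t = n)%N by rewrite /s /t cardsC card_ord.
have rd : (r <= d)%N by rewrite -[d in X in (_ <= X)%N]card_ord max_card.
pose M : R := 1 + \sum_j \sum_k nc (Cf j 0 k).
have M1 : 1 <= M by rewrite lerDl; apply: sumr_ge0 => j _; apply: sumr_ge0 => k _; exact: normc_ge0.
have Mj j : \sum_k nc (Cf j 0 k) <= M.
  rewrite /M (bigD1 j)//= addrCA lerDl addr_ge0//.
  by apply: sumr_ge0 => i _; apply: sumr_ge0 => k _; exact: normc_ge0.
(* Chosen such that [(M * c) ^+ d <= K], where [M] bounds the coefficient sums of the forms. *)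
pose c : R := Num.min 1 K / M.
have c0 : 0 < c by rewrite divr_gt0 ?lt_min ?ltr01//; exact: lt_le_trans ltr01 M1.
have Mc : (M * c) ^+ d <= K.
  have m0 : 0 <= Num.min 1 K by rewrite le_min ler01 ltW.
  rewrite /c mulrC divfK; last by rewrite gt_eqF// (lt_le_trans ltr01).
  apply: (@le_trans _ _ (Num.min 1 K)); last by rewrite ge_min lexx orbT.
  by rewrite -(prednK d0) exprS ler_piMr// exprn_ile1// ge_min lexx.
clearbody c.
pose rho i : R := c * 2 ^+ (s * i).
pose eps i : R := c / 2 ^+ (t * i).
have rho0 i : 0 < rho i by rewrite mulr_gt0// exprn_gt0.
have eps0 i : 0 < eps i by rewrite divr_gt0// exprn_gt0.
have er i : eps i <= rho i.
  rewrite ler_wpM2l ?(ltW c0)//; apply: (@le_trans _ _ 1); last by rewrite exprn_ege1// ler1n.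
  by rewrite invf_le1 ?exprn_gt0// exprn_ege1// ler1n.
pose w i k := if k \in S then eps i else rho i.
have w0 i k : 0 < w i k by rewrite /w; case: ifP.
(* Disjointness comes from the coordinate [p], outside [S], which is confined to the upper half of
   its range. *)
pose A i k : set mR := if k == p then [set` `]rho i / 2, rho i]] else [set y : mR | `|y| <= w i k].
have mA i k : measurable (A i k).
  by rewrite /A; case: ifP => _; [exact: measurable_itv|rewrite abs_le_itv; exact: measurable_itv].
pose E i : set (n.-tuple mR) := tuple_lin T @^-1` [set y | forall k, A i k (tnth y k)].
have mE i : measurable (E i).
  rewrite -[X in measurable X]setTI; apply: measurable_tuple_lin => //.
  exact: measurable_tuple_box.
have EA i x k : E i x -> `|\sum_q T k q * tnth x q| <= w i k.
  move=> /(_ k); rewrite tnth_mktuple /A; case: eqP => [->|//] /=.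
  rewrite in_itv /= /w; move: pS; rewrite inE => /negPf -> /andP[h1 h2].
  by rewrite ger0_norm// (le_trans _ (ltW h1))// divr_ge0// ltW.
have ED i : E i `<=` form_body L K.
  move=> x Ex /=; apply: le_trans Mc.
  have Lx j : nc (eval_form (L j) (tnth x)) <= M * (if j \in J then eps i else rho i).
    have -> : eval_form (L j) (tnth x) =
        \sum_k Cf j 0 k * (\sum_q T k q * tnth x q)%:C%C.
      rewrite /eval_form LC; under eq_bigr do rewrite mxE mulr_suml.
      rewrite exchange_big; apply: eq_bigr => k _ /=.
      rewrite rmorph_sum mulr_sumr; apply: eq_bigr => q _.
      by rewrite mxE -mulrA; congr (_ * _); rewrite [RHS](rmorphM (real_complex R)).
    apply: le_trans (normc_sum_le _ _) _.
    apply: (@le_trans _ _ (\sum_k nc (Cf j 0 k) * (if j \in J then eps i else rho i))).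
      apply: ler_sum => k _; rewrite Normc.normcM normc_real.
      case: ifP => [|_]; last first.
        rewrite ler_wpM2l ?normc_ge0//; apply: le_trans (EA _ _ _ Ex) _.
        by rewrite /w; case: ifP.
      rewrite inE => /forallP/(_ k)/orP[kS|/eqP ->].
        by rewrite ler_wpM2l ?normc_ge0//; apply: le_trans (EA _ _ _ Ex) _; rewrite /w kS.
      by rewrite Normc.normc0 !mul0r.
    by rewrite -mulr_suml ler_wpM2r// ltW//; case: ifP.
  apply: (@le_trans _ _ (\prod_j (M * (if j \in J then eps i else rho i)))).
    by apply: ler_prod => j _; rewrite normc_ge0 Lx.
  rewrite big_split /= prodr_const card_ord exprMn prod_if.
  rewrite ler_wpM2l ?exprn_ge0//; first exact: le_trans ler01 M1.
  have -> : #|~: J| = (d - r)%N by rewrite cardsCs finset.setCK card_ord.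
  rewrite -/r /eps /rho !exprMn mulrACA -exprD subnKC// -exprVn -!exprM.
  rewrite ler_piMr ?exprn_ge0 ?(ltW c0)// exprVn ler_pdivrMl ?exprn_gt0// mulr1.
  apply: ler_weXn2l; first by rewrite ler1n.
  (* This restates [dS]: the decay of the [r] forms in [J], which involve only coordinates in [S],
     outweighs the growth of the other ones. *)
  have : (s * (d - r) <= t * r)%N.
    by rewrite mulnBr leq_subLR mulnC -mulnDl st.
  by rewrite mulnAC (mulnAC t) => h; rewrite leq_mul2r h orbT.
(* The division by 4 is due to the side at [p], of length [rho i / 2] instead of [2 * rho i]. *)
pose v0 : R := `|\det T|^-1 * (c ^+ n * 2 ^+ n / 4).
have v00 : 0 < v0.
  rewrite mulr_gt0// ?invr_gt0 ?normr_gt0 -?unitfE -?unitmxE//.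
  by rewrite divr_gt0// mulr_gt0// exprn_gt0.
have muE i : lebesgue_tuple R n (E i) = v0%:E.
  have [_ [_ ->]] := scales_volume_lin uT; last exact: measurable_tuple_box.
  rewrite lebesgue_tuple_box// EFinM; congr (_ * _)%E.
  rewrite (eq_bigr (fun k => (2 * w i k * (if k == p then 4^-1 else 1))%:E)); last first.
    move=> k _; rewrite /A; case: eqP => [->|_]; last first.
      by rewrite lebesgue_abs_le ?mulr1// ltW.
    rewrite lebesgue_measure_itv /= lte_fin /w; move: pS; rewrite inE => /negPf ->.
    by rewrite ltr_pdivrMr// ltr_pMr// ltr1n -EFinD; congr EFin; field.
  rewrite prodEFin; congr EFin; rewrite big_split /= -big_mkcond big_pred1_eq.
  congr (_ / _); rewrite big_split /= prodr_const card_ord mulrC; congr (_ * _).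
  rewrite prod_if -/s -/t /eps /rho !exprMn mulrACA -exprD st -exprVn -!exprM.
  by rewrite exprVn mulnAC (mulnAC s) (mulnC s t) mulVf ?mulr1// expf_neq0.
have tE : trivIset setT E.
  apply/trivIsetP => i j _ _.
  wlog ij : i j / (i < j)%N.
    move=> H; rewrite neq_ltn => /orP[ij|ij]; first by apply: H; rewrite ?ltn_eqF.
    by rewrite setIC; apply: H; rewrite ?ltn_eqF.
  move=> _; apply/seteqP; split => // x [/(_ p) + /(_ p)].
  rewrite !tnth_mktuple /A eqxx /= !in_itv /= => /andP[_ h1] /andP[h2 _].
  have : rho i <= rho j / 2.
    rewrite ler_pdivlMr// -mulrA -exprSr ler_pM2l//; apply: ler_weXn2l; first by rewrite ler1n.
    apply: (@leq_trans (s * i.+1)); last by rewrite leq_mul2l ij orbT.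
    by rewrite mulnS -add1n leq_add2r.
  by move=> h3; have := le_lt_trans h1 (le_lt_trans h3 h2); rewrite ltxx.
have big N : ((N%:R * v0)%:E <= lebesgue_tuple R n (form_body L K))%E.
  have -> : (N%:R * v0)%:E = lebesgue_tuple R n (\bigcup_(i : 'I_N) E i).
    rewrite measure_fin_union//.
      rewrite (eq_bigr (fun=> v0%:E)) => [|i _]; last exact: muE.
      by rewrite sumEFin sumr_const card_ord mulr_natl.
    by apply/trivIsetP => i j _ _ ij; have /trivIsetP := tE; apply.
  apply: le_measure; rewrite ?inE; [exact: measurable_fin_union|exact: measurable_form_body|].
  by move=> x [i _ Ex]; exact: ED Ex.
apply/eqP; rewrite -leye_eq leNgt; apply/negP => fin.
have fn : lebesgue_tuple R n (form_body L K) \is a fin_num by rewrite ge0_fin_numE.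
set V := fine (lebesgue_tuple R n (form_body L K)).
have := big (Num.trunc (V / v0)).+1; rewrite -(fineK fn) lee_fin -/V -ler_pdivlMr//.
by rewrite leNgt truncnS_gt.
Qed.

End InfiniteVolume.

(** * Volume of a minimal tuple *)

Section Abel.
Variable R : realType.

(** Write each value as the largest one minus the increments above its index, and compare the
    coefficients of every increment. The strict inequality between integers leaves a surplus of at
    least 1 for each, and these surpluses add up to [u ord_max - u ord0]. *)
Lemma abel_weighted_sum n d (u : 'I_n.+1 -> R) (kk : 'I_d -> 'I_n.+1) :
  (forall i j : 'I_n.+1, (i <= j)%N -> u i <= u j) ->
  (forall l : nat, (l < n)%N -> (n.+1 * #|[set j | kk j <= l]%SET| < d * l.+1)%N) ->
  d%:R * (\sum_k u k) + (u ord_max - u ord0) <= n.+1%:R * \sum_j u (kk j).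
Proof.
move=> umono cnt; pose U i := u (inord i).
have UE (k : 'I_n.+1) : u k = U n - \sum_(l < n | (k <= l)%N) (U l.+1 - U l).
  have : \sum_(k <= l < n) (U l.+1 - U l) = U n - U k.
    by apply: telescope_sumr; rewrite -ltnS.
  rewrite big_geq_mkord /= => ->.
  by rewrite subKr /U inord_val.
have U0 l : (l < n)%N -> 0 <= U l.+1 - U l.
  by move=> ln; rewrite subr_ge0; apply: umono; rewrite !inordK ?ltnS// ltnW.
have SE (J : finType) (f : J -> 'I_n.+1) : \sum_j u (f j) =
    #|J|%:R * U n - \sum_(l < n) #|[set j | (f j <= l)%N]%SET|%:R * (U l.+1 - U l).
  under eq_bigr do rewrite UE.
  rewrite sumrB sumr_const -[X in X - _]mulr_natl; congr (_ - _).
  under eq_bigr do rewrite big_mkcond /=.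
  rewrite exchange_big /=; apply: eq_bigr => l _.
  by rewrite -big_mkcond sumr_const mulr_natl; congr (_ *+ _); apply: eq_card => j; rewrite inE.
rewrite (SE _ kk) (SE _ id) !card_ord.
have -> : u ord_max - u ord0 = \sum_(l < n) (U l.+1 - U l).
  have := @telescope_sumr _ 0 n U (leq0n n); rewrite big_mkord => ->.
  by congr (u _ - u _); apply/val_inj; rewrite /= inordK.
rewrite !mulrBr !mulr_sumr.
have -> : n.+1%:R * (d%:R * U n) = d%:R * (n.+1%:R * U n) by ring.
suff : \sum_(l < n) (U l.+1 - U l) +
    \sum_(l < n) n.+1%:R * (#|[set j | (kk j <= l)%N]%SET|%:R * (U l.+1 - U l)) <=
    \sum_(l < n) d%:R * (#|[set j : 'I_n.+1 | (j <= l)%N]%SET|%:R * (U l.+1 - U l)) by lra.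
rewrite -big_split /=; apply: ler_sum => l _.
have -> : #|[set j : 'I_n.+1 | (j <= l)%N]%SET| = l.+1.
  rewrite -[RHS](card_ord l.+1) -sum1_card -[RHS]sum1_card.
  rewrite (big_ord_widen_cond n.+1 xpredT (fun=> 1%N)) ?ltnS ?(ltnW (ltn_ord l))//.
  by apply: eq_bigl => j; rewrite inE ltnS.
rewrite !mulrA -[X in X + _]mul1r -mulrDl ler_wpM2r ?U0//.
by rewrite -!natrM nat1r ler_nat cnt.
Qed.

End Abel.

Section MinimalTuple.
Variable R : realType.
Local Notation C := (R[i]).
Local Notation nc := (@Normc.normc R).
Variables (n d : nat) (l : 'I_d -> 'rV[C]_n).
Local Notation M := (real_parts_mx l).

Lemma real_parts_mx_perm (I : 'I_n -> 'I_d * bool) (s : {perm 'I_n}) :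
  `|\det (M (I \o s))| = `|\det (M I)|.
Proof.
have -> : M (I \o s) = row_perm s (M I) by apply/matrixP => i j; rewrite !mxE.
by rewrite row_permE det_mulmx det_perm normrM normr_sign mul1r.
Qed.

Lemma coordE (I : 'I_n -> 'I_d * bool) q k : \det (M I) != 0 ->
  (real_part (l q.1) q.2 *m invmx (M I)) 0 k =
  \det (M (fun i => if i == k then q else I i)) / \det (M I).
Proof.
move=> dI; have uI : M I \in unitmx by rewrite unitmxE unitfE.
have -> : M (fun i => if i == k then q else I i) =
    \matrix_i (if i == k then real_part (l q.1) q.2 else row i (M I)).
  by apply/matrixP => i j; rewrite !mxE; case: (i == k); rewrite !mxE.
by rewrite det_repl_row// mulfK.
Qed.

Lemma sorting_perm m (b : 'I_m -> R) : exists s : {perm 'I_m},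
  forall i j : 'I_m, (i <= j)%N -> b (s i) <= b (s j).
Proof.
pose t := [tuple b i | i < m].
have /tuple_permP[s sE] : perm_eq (sort_tuple <=%O t) t by rewrite perm_sort.
have srt : sorted <=%O (sort_tuple <=%O t) by exact: sort_le_sorted.
exists s => i j ij.
have bE k : b (s k) = nth 0 (sort_tuple <=%O t) k.
  by rewrite sE (_ : nth _ _ _ = tnth [tuple tnth t (s i) | i < m] k) ?(tnth_nth 0)// -(tnth_nth 0) !tnth_mktuple.
rewrite !bE; apply: (sorted_leq_nth le_trans le_refl) => //.
- by rewrite inE size_tuple.
- by rewrite inE size_tuple.
Qed.

(** Exchange argument: in a tuple minimizing [f], replacing the [k]-th member by [q] cannot decrease
    [f], and by [coordE] the change of determinant is the [k]-th coordinate of [q]. Sorting the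
    tuple preserves [f]. *)
Lemma minimal_tuple (X : 'I_d -> R) (I0 : 'I_n -> 'I_d * bool) :
  (forall j, 0 < X j) -> \det (M I0) != 0 ->
  exists I : 'I_n -> 'I_d * bool, [/\ \det (M I) != 0,
    forall i j : 'I_n, (i <= j)%N -> X (I i).1 <= X (I j).1 &
    forall q k, `|(real_part (l q.1) q.2 *m invmx (M I)) 0 k| * X (I k).1 <= X q.1].
Proof.
move=> X0 dI0.
have Mext I I' : I =1 I' -> M I = M I'.
  by move=> II; apply/matrixP => i j; rewrite !mxE II.
pose P (I : {ffun 'I_n -> 'I_d * bool}) := \det (M I) != 0.
pose f (I : {ffun 'I_n -> 'I_d * bool}) := (\prod_k X (I k).1) / `|\det (M I)|.
have PI0 : P [ffun k => I0 k] by rewrite /P (Mext _ I0)// => k; rewrite ffunE.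
case: (@arg_minP _ _ _ _ P f PI0) => J PJ Jmin.
have [s sP] := sorting_perm (fun k => X (J k).1).
have dJs : \det (M (J \o s)) != 0 by rewrite -normr_gt0 real_parts_mx_perm normr_gt0.
exists (J \o s); split => // q k.
rewrite coordE//; set I' := fun i => _.
have [->|dI'] := eqVneq (\det (M I')) 0; first by rewrite mul0r normr0 mul0r ltW.
have P' : P [ffun k => I' k] by rewrite /P (Mext _ I')// => i; rewrite ffunE.
have := Jmin _ P'; rewrite /f (Mext [ffun k => I' k] I') => [|i]; last by rewrite ffunE.
under [X in _ <= X / _]eq_bigr do rewrite ffunE.
rewrite -(real_parts_mx_perm J s) (reindex_inj (@perm_inj _ s)) /=.
rewrite (bigD1 k)//= [in X in _ <= X](bigD1 k)//= {1 2}/I' eqxx.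
have -> : \prod_(i | i != k) X (I' i).1 = \prod_(i | i != k) X (J (s i)).1.
  by apply: eq_bigr => i ik; rewrite /I' (negPf ik).
set Y := \prod_(i | _) _.
have Y0 : 0 < Y by exact: prodr_gt0.
rewrite normrM normfV.
have : 0 < `|\det (M I')| by rewrite normr_gt0.
have : 0 < `|\det (M (J \o s))| by rewrite normr_gt0.
move: `|_| `|_| => a b a0 b0.
rewrite -(ler_pM2r (divr_gt0 b0 Y0)); congr (_ <= _); field; rewrite !gt_eqF//.
Qed.

End MinimalTuple.

Section Pointwise.
Variable R : realType.
Local Notation C := (R[i]).
Local Notation nc := (@Normc.normc R).
Variables (n d : nat) (l : 'I_d -> 'rV[C]_n).
Local Notation M := (real_parts_mx l).

(** The rows of [T] are an arbitrary basis of real forms, and the forms counted are those in the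
    complex span of the rows in [S]. So this limits the number of forms in each proper nonzero
    subspace defined over the reals. *)
Definition stable := forall (T : 'M[R]_n) (Cf : 'I_d -> 'rV[C]_n) (S : {set 'I_n}),
  T \in unitmx -> (forall j, l j = Cf j *m map_mx (real_complex R) T) ->
  (0 < #|S|)%N -> (0 < #|~: S|)%N ->
  (n * #|[set j | [forall k, (k \in S) || (Cf j 0%R k == 0%R)]]%SET| < d * #|S|)%N.

Lemma mulmx_real (v : 'rV[C]_n) (T : 'M[R]_n) k :
  (v *m map_mx (real_complex R) T) 0 k = eval_form v (fun i => T i k).
Proof. by rewrite mxE; apply: eq_bigr => i _; rewrite mxE. Qed.

Lemma normc_mulmx_real (v : 'rV[C]_n) (T : 'M[R]_n) k :
  nc ((v *m map_mx (real_complex R) T) 0 k) =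
  Num.sqrt ((real_part v false *m T) 0 k ^+ 2 + (real_part v true *m T) 0 k ^+ 2).
Proof. by rewrite mulmx_real nc_eval_form !mxE. Qed.

(** If no [n] real and imaginary parts are independent, the matrix of all of them has rank less than
    [n]. *)
Lemma common_zero : (forall I, \det (M I) = 0) ->
  exists2 x : 'cV[R]_n, x != 0 & forall j e, real_part (l j) e *m x = 0.
Proof.
move=> dI0.
pose A : 'M[R]_(#|{: 'I_d * bool}|, n) :=
  \matrix_i real_part (l (enum_val i).1) (enum_val i).2.
have nfA : ~~ row_full A.
  apply/negP => fA; have := fullrowsub_unit fA.
  rewrite unitmxE (_ : rowsub _ A = M (fun k => enum_val (fullrankfun fA k))).
    by rewrite dI0 unitr0.
  by apply/matrixP => i j; rewrite !mxE.
have : kermx A^T != 0.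
  by rewrite -mxrank_eq0 mxrank_ker mxrank_tr subn_eq0 -ltnNge ltn_neqAle nfA rank_leq_col.
move=> /rowV0Pn[v /sub_kermxP vA v0]; exists v^T; first by rewrite trmx_eq0.
move=> j e; have : A *m v^T = 0 by rewrite -[A]trmxK -trmx_mul vA trmx0.
move/matrixP/(_ (enum_rank (j, e))) => Aj; apply/matrixP => i k; rewrite !ord1.
have := Aj 0; rewrite !mxE; apply: etrans; apply: eq_bigr => q _.
by rewrite [in RHS]mxE enum_rankK.
Qed.

(** Otherwise take a common zero of the parts as the [p]-th basis vector: all the forms then lie in
    the span of the other [n.-1] coordinates, against stability. *)
Lemma stable_basis : (1 < n)%N -> stable -> exists I, \det (M I) != 0.
Proof.
move=> n1 st; apply: contrapT => nI.
have [|x x0 xl] := common_zero.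
  by move=> I; apply/eqP/negPn/negP => dI; apply: nI; exists I.
have [p xp] : exists p, x p 0 != 0.
  apply/existsP; apply: contraT; rewrite negb_exists => /forallP xz.
  by case/eqP: x0; apply/matrixP => i j; rewrite ord1 mxE; exact/eqP/negbNE.
pose V : 'M[R]_n := (\matrix_i (if i == p then x^T else row i 1%:M))^T.
have uV : V \in unitmx.
  rewrite unitmxE det_tr det_repl_row ?unitmx1// invmx1 mulmx1 det1 mulr1 unitfE.
  by rewrite mxE.
have := st (invmx V) (fun j => l j *m map_mx (real_complex R) V) (~: [set p])%SET.
rewrite unitmx_inv uV cardsC1 card_ord finset.setCK cards1.
have lV j : l j = l j *m map_mx (real_complex R) V *m map_mx (real_complex R) (invmx V).
  by rewrite -mulmxA -map_mxM mulmxV// map_mx1 mulmx1.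
have n10 : (0 < n.-1)%N by rewrite -subn1 subn_gt0.
move=> /(_ isT lV n10 isT); apply/negP; rewrite -leqNgt.
suff -> : #|[set j | [forall k, (k \in ~: [set p]) ||
    ((l j *m map_mx (real_complex R) V) 0%R k == 0%R)]]%SET| = d.
  by rewrite mulnC leq_mul// leq_pred.
rewrite -[RHS](card_ord d); apply: eq_card => j; rewrite !inE.
apply/forallP => k; rewrite !inE; case: eqVneq => //= ->.
rewrite -normc_eq0 normc_mulmx_real.
have E e : (real_part (l j) e *m V) 0 p = 0.
  have := xl j e => /matrixP/(_ 0 0); rewrite mxE [RHS]mxE => <-.
  by rewrite mxE; apply: eq_bigr => i _; rewrite !mxE eqxx mxE.
by rewrite !E expr0n addr0 sqrtr0.
Qed.

Section Tuple.
Variables (X : 'I_d -> R) (I : 'I_n -> 'I_d * bool) (alpha : R).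
Hypotheses (X0 : forall j, 0 < X j) (dI : \det (M I) != 0) (alpha1 : 1 <= alpha)
  (FX : alpha * \prod_j X j <= 1)
  (XI : forall q k, `|(real_part (l q.1) q.2 *m invmx (M I)) 0 k| * X (I k).1 <= X q.1).

(** Up to the factor [2 ^+ n], the volume of the box in which the [k]-th form of the tuple is at
    most [X (I k).1]. *)
Let P := (\prod_k X (I k).1) / `|\det (M I)|.

Lemma tuple_volume_gt0 : 0 < P.
Proof. by rewrite divr_gt0 ?normr_gt0// prodr_gt0. Qed.

(** [T] takes the unit cube to the box of the tuple, and [XI] bounds the coefficients of each [l j]
    composed with [T] by a multiple of [X j]. Division by the [n]-th root [tau] of [P] makes the
    determinant 1 in absolute value, so that the hypothesis on [m] applies. *)
Lemma tuple_volume_le_height m : (0 < n)%N -> 0 <= m ->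
  (forall T : 'M[R]_n, `|\det T| = 1 ->
     m <= alpha * \prod_j hermitian_norm (l j *m map_mx (real_complex R) T)) ->
  m ^+ n * P ^+ d <= (2 * n%:R) ^+ (d * n).
Proof.
move=> n0 m0 Hm; have P0 := tuple_volume_gt0.
pose tau := P `^ (n%:R^-1).
have tau0 : 0 < tau by exact: powR_gt0.
have tauE : tau ^+ n = P.
  rewrite -powR_mulrn ?(ltW tau0)// -powRrM mulVf ?powRr1 ?(ltW P0)//.
  by rewrite pnatr_eq0 -lt0n.
pose T := invmx (M I) *m diag_mx (\row_k X (I k).1).
have dT : `|\det T| = P.
  rewrite det_mulmx det_inv det_diag normrM normfV mulrC ger0_norm.
    by congr (_ / _); apply: eq_bigr => k _; rewrite mxE.
  by apply: prodr_ge0 => k _; rewrite mxE ltW.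
have lT j : hermitian_norm (l j *m map_mx (real_complex R) T) <= 2 * n%:R * X j.
  have nX : 0 <= 2 * n%:R * X j by rewrite !mulr_ge0// ltW.
  rewrite -[leRHS]ger0_norm// -sqrtr_sqr ler_sqrt ?sqr_ge0//.
  have cX e k : ((real_part (l j) e *m T) 0 k) ^+ 2 <= X j ^+ 2.
    rewrite mulmxA mul_mx_diag mxE [X in _ * X]mxE -ler_sqrt ?sqr_ge0// !sqrtr_sqr.
    by rewrite normrM !(gtr0_norm (X0 _)); exact: XI (j, e) k.
  apply: (@le_trans _ _ (\sum_(k < n) 2 * X j ^+ 2)).
    apply: ler_sum => k _; rewrite normc_mulmx_real sqr_sqrtr ?addr_ge0 ?sqr_ge0//.
    by have := cX false k; have := cX true k; lra.
  rewrite sumr_const card_ord -[leLHS]mulr_natl !exprMn mulrA ler_wpM2r ?sqr_ge0//.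
  have : 1 <= n%:R :> R by rewrite ler1n.
  nra.
have := Hm (tau^-1 *: T).
rewrite detZ normrM dT normrX normfV gtr0_norm// exprVn tauE mulVf ?gt_eqF// => /(_ erefl).
under eq_bigr do rewrite map_mxZ -scalemxAr hermitian_normZ normc_real normfV gtr0_norm//.
rewrite big_split /= prodr_const card_ord => mT.
have m1 : m * tau ^+ d <= (2 * n%:R) ^+ d.
  rewrite -ler_pdivlMr ?exprn_gt0//; apply: (le_trans mT).
  rewrite exprVn mulrCA mulrC ler_pM2r ?invr_gt0 ?exprn_gt0//.
  apply: (@le_trans _ _ (alpha * \prod_j (2 * n%:R * X j))).
    rewrite ler_wpM2l ?(le_trans ler01)//; apply: ler_prod => j _.
    by rewrite hermitian_norm_ge0 lT.
  by rewrite big_split /= prodr_const card_ord mulrCA ler_piMr// exprn_ge0// mulr_ge0.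
rewrite exprM -tauE -exprM mulnC exprM -exprMn lerXn2r ?nnegrE ?mulr_ge0 ?exprn_ge0 ?mulr_ge0//.
exact: ltW.
Qed.

End Tuple.
End Pointwise.

Section FarRegion.
Variable R : realType.
Local Notation C := (R[i]).
Local Notation nc := (@Normc.normc R).

Lemma ln_prod (J : Type) (s : seq J) (f : J -> R) : (forall j, 0 < f j) ->
  ln (\prod_(j <- s) f j) = \sum_(j <- s) ln (f j).
Proof.
move=> f0; elim: s => [|j s IH]; first by rewrite !big_nil ln1.
by rewrite !big_cons lnM ?posrE// ?IH// prodr_gt0.
Qed.

Variables (n d : nat) (l : 'I_d -> 'rV[C]_n.+1).
Local Notation M := (real_parts_mx l).
Variables (X : 'I_d -> R) (I : 'I_n.+1 -> 'I_d * bool) (eta : R).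
Hypotheses (X0 : forall j, 0 < X j) (dI : \det (M I) != 0)
  (FX : \prod_j X j <= 1) (l0 : forall j, l j != 0) (stl : stable l)
  (XI : forall q k, `|(real_part (l q.1) q.2 *m invmx (M I)) 0 k| * X (I k).1 <= X q.1)
  (Xsorted : forall i j : 'I_n.+1, (i <= j)%N -> X (I i).1 <= X (I j).1)
  (eta0 : 0 < eta)
  (etaI : forall q k, (real_part (l q.1) q.2 *m invmx (M I)) 0 k != 0 ->
     eta <= `|(real_part (l q.1) q.2 *m invmx (M I)) 0 k|).

(** Each [X j] is at least [eta] times the largest [X (I k).1] whose coordinate occurs in [l j].
    Stability keeps these positions from being too low, and partial summation of logarithms turns
    its strictness into the gain of the ratio. *)
Lemma tuple_product_le_ratio k :
  (\prod_k X (I k).1) ^+ d * (X (I k).1 / X (I ord0).1) * eta ^+ (d * n.+1) <= 1.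
Proof.
pose Cf j := l j *m map_mx (real_complex R) (invmx (M I)).
have uI : M I \in unitmx by rewrite unitmxE unitfE.
have lCf j : l j = Cf j *m map_mx (real_complex R) (M I).
  by rewrite -mulmxA -map_mxM mulVmx// map_mx1 mulmx1.
have Cfk j k' : Cf j 0 k' != 0 -> eta * X (I k').1 <= X j.
  rewrite -normc_eq0 normc_mulmx_real => h.
  have [e he] : exists e, (real_part (l j) e *m invmx (M I)) 0 k' != 0.
    apply: contrapT => ne; case/negP: h.
    have E e : (real_part (l j) e *m invmx (M I)) 0 k' = 0.
      by apply/eqP/negPn/negP => he; apply: ne; exists e.
    by rewrite !E expr0n addr0 sqrtr0.
  apply: le_trans (XI (j, e) k'); rewrite ler_wpM2r ?(ltW (X0 _))//.
  exact: (etaI (q := (j, e))).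
have exk j : exists k', Cf j 0 k' != 0.
  apply/rV0Pn; apply: contra_neq (l0 j) => Cj.
  by rewrite lCf Cj mul0mx.
(* [kk j] is the last member of the sorted tuple that occurs in [l j]. *)
have /choice[kk kkP] j : exists q : 'I_n.+1,
    Cf j 0 q != 0 /\ forall k', Cf j 0 k' != 0 -> (k' <= q)%N.
  have [k' hk'] := exk j.
  case: (@arg_maxnP _ k' (fun k => Cf j 0 k != 0) val hk') => q hq qm.
  by exists q.
pose u k := ln (X (I k).1).
have umono (i j : 'I_n.+1) : (i <= j)%N -> u i <= u j.
  by move=> ij; rewrite /u ler_ln ?posrE// Xsorted.
(* The forms with [kk j <= q] are those in the span of the first [q.+1] members of the tuple. *)
have cnt q : (q < n)%N -> (n.+1 * #|[set j | kk j <= q]%SET| < d * q.+1)%N.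
  move=> qn; pose S := [set k' : 'I_n.+1 | (k' <= q)%N]%SET.
  have cS : #|S| = q.+1.
    rewrite -[RHS](card_ord q.+1) -sum1_card -[RHS]sum1_card.
    rewrite (big_ord_widen_cond n.+1 xpredT (fun=> 1%N)) ?ltnS ?(ltnW qn)//.
    by apply: eq_bigl => j; rewrite inE ltnS.
  have cS' : (0 < #|~: S|)%N by rewrite cardsCs finset.setCK cS card_ord subn_gt0 ltnS.
  have := @stl _ _ S uI lCf; rewrite cS => /(_ isT cS'); congr (_ < _)%N; congr (_ * _)%N; apply: eq_card => j.
  rewrite !inE; apply/forallP/idP => [h|h k'].
    have := h (kk j); rewrite inE => /orP[//|/eqP h0].
    by have := (kkP j).1; rewrite h0 eqxx.
  rewrite inE; have [//|h'] := leqP k' q; rewrite /=.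
  apply: contraTT h' => h'; rewrite -leqNgt.
  exact: leq_trans ((kkP j).2 _ h') h.
have abel := abel_weighted_sum umono cnt.
have uk : u k <= u ord_max by apply: umono; rewrite -ltnS.
have skk : \sum_j u (kk j) <= - (d%:R * ln eta).
  have : \sum_j (ln eta + u (kk j)) <= \sum_j ln (X j).
    apply: ler_sum => j _; rewrite /u -lnM ?posrE// ler_ln ?posrE ?mulr_gt0//.
    exact: Cfk (kkP j).1.
  rewrite -ln_prod// big_split /= sumr_const card_ord -[ln eta *+ d]mulr_natl.
  have : ln (\prod_j X j) <= 0 by exact: ln_le0.
  lra.
set Y := _ * _ * _.
have Y0 : 0 < Y.
  by rewrite !mulr_gt0// ?invr_gt0// ?exprn_gt0// prodr_gt0.
rewrite -ler_ln ?posrE// ln1 /Y !lnM ?posrE ?invr_gt0 ?exprn_gt0 ?mulr_gt0 ?exprn_gt0 ?invr_gt0 ?prodr_gt0//.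
rewrite lnV ?posrE// !lnXn ?prodr_gt0// ln_prod//.
rewrite -/(u k) -/(u ord0) -[_ *+ d]mulr_natl -[_ *+ (d * n.+1)]mulr_natl natrM.
have : n.+1%:R * (\sum_j u (kk j)) <= n.+1%:R * - (d%:R * ln eta).
  by rewrite ler_wpM2l.
rewrite /u in abel uk *; lra.
Qed.

End FarRegion.

(** * Covering by boxes *)

Section Covering.
Variable R : realType.
Local Notation mR := (measurableTypeR R).

Lemma powR_invn_Xn (x : R) k : (0 < k)%N -> 0 <= x -> (x `^ k%:R^-1) ^+ k = x.
Proof.
move=> k0 x0; rewrite -powR_mulrn ?powR_ge0// -powRrM mulVf ?powRr1//.
by rewrite pnatr_eq0 -lt0n.
Qed.

Lemma powR_exprAC (x a : R) k : 0 <= x -> (x `^ a) ^+ k = (x ^+ k) `^ a.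
Proof. by move=> x0; rewrite -!powR_mulrn ?powR_ge0// -!powRrM mulrC. Qed.

Lemma truncated_geometric_sum (q : R) w N : 0 < q -> q < 1 ->
  \sum_(o < N) (if (o < w)%N then 1 else q ^+ (o - w)) <= w%:R + (1 - q)^-1.
Proof.
move=> q0 q1; have q10 : 0 < 1 - q by rewrite subr_gt0.
have E : \sum_(o < N) (if (o < w)%N then 1 else q ^+ (o - w)) =
    (minn N w)%:R + (1 - q ^+ (N - w)) / (1 - q).
  elim: N => [|N IH]; first by rewrite big_ord0 min0n sub0n expr0 subrr mul0r addr0.
  rewrite big_ord_recr IH; case: (ltnP (ord_max : 'I_N.+1) w) => /= Nw.
    rewrite (minn_idPl Nw).
    have /eqP -> : (N - w == 0)%N by rewrite subn_eq0 ltnW.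
    have /eqP -> : (N.+1 - w == 0)%N by rewrite subn_eq0.
    by rewrite expr0 subrr mul0r !addr0 -natr1.
  rewrite (minn_idPr (leqW Nw)) subSn// exprS -addrA; congr (_ + _).
  by field; rewrite gt_eqF.
rewrite E lerD ?ler_nat ?geq_minr// -[leRHS]mul1r ler_pM2r ?invr_gt0//.
by rewrite lerBlDr lerDl exprn_ge0// ltW.
Qed.

Variables (n d w : nat) (A0 M0 : R).
Hypotheses (n0 : (0 < n)%N) (d0 : (0 < d)%N) (A00 : 0 < A0) (M00 : 0 < M0)
  (wP : M0 <= A0 * 2 ^+ w).

(** The [n]-th root of the largest P with [P ^+ d <= A0] and [P ^+ d * 2 ^+ o <= M0]. With one such
    root for each of the [n] offsets, the sum over all offsets becomes an [n]-th power. *)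
Definition shell_bound (o : nat) : R := (Num.min A0 (M0 / 2 ^+ o)) `^ (d * n)%:R^-1.

Definition shell_ratio : R := (2^-1) `^ (d * n)%:R^-1.

Let dn0 : (0 < d * n)%N. Proof. by rewrite muln_gt0 d0. Qed.

Lemma shell_ratio_gt0 : 0 < shell_ratio.
Proof. by apply: powR_gt0; rewrite invr_gt0. Qed.

Lemma shell_ratio_lt1 : shell_ratio < 1.
Proof.
have h : shell_ratio ^+ (d * n) < 1 by rewrite powR_invn_Xn//; lra.
rewrite ltNge; apply/negP => h1; move: h; apply/negP; rewrite -leNgt.
exact: exprn_ege1.
Qed.

Lemma min_shell_gt0 o : 0 < Num.min A0 (M0 / 2 ^+ o).
Proof. by rewrite lt_min A00 divr_gt0// exprn_gt0. Qed.

Lemma shell_bound_le o :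
  shell_bound o <= A0 `^ (d * n)%:R^-1 * (if (o < w)%N then 1 else shell_ratio ^+ (o - w)).
Proof.
have th0 : 0 <= (d * n)%:R^-1 :> R by rewrite invr_ge0.
case: ltnP => ow; rewrite /shell_bound.
  rewrite mulr1 ge0_ler_powR ?nnegrE ?(ltW (min_shell_gt0 _)) ?(ltW A00)//.
  by rewrite ge_min lexx.
rewrite /shell_ratio powR_exprAC ?invr_ge0//.
rewrite -powRM ?exprn_ge0 ?invr_ge0 ?(ltW A00)//.
rewrite ge0_ler_powR ?nnegrE ?mulr_ge0 ?exprn_ge0 ?invr_ge0 ?(ltW (min_shell_gt0 _)) ?(ltW A00)//.
rewrite ge_min; apply/orP; right; rewrite ler_pdivrMr ?exprn_gt0// exprVn -mulrA.
by apply: (le_trans wP); rewrite ler_pM2l// -{2}(subnK ow) exprD mulKf// expf_neq0.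
Qed.

(** The first [w] shells are bounded through [A0], and from there on [M0 / 2 ^+ o] decays
    geometrically. With [w] logarithmic in the final application, this is one factor of the
    logarithm. *)
Lemma sum_shell_bound_le N :
  \sum_(o < N) shell_bound o <= A0 `^ (d * n)%:R^-1 * (w%:R + (1 - shell_ratio)^-1).
Proof.
apply: le_trans (ler_wpM2l (powR_ge0 _ _)
  (truncated_geometric_sum w N shell_ratio_gt0 shell_ratio_lt1)).
by rewrite mulr_sumr; apply: ler_sum => o _; exact: shell_bound_le.
Qed.

Lemma le_prod_shell_bound (P : R) (o : 'I_n -> nat) : 0 <= P -> P ^+ d <= A0 ->
  (forall k, P ^+ d * 2 ^+ (o k) <= M0) -> P <= \prod_k shell_bound (o k).
Proof.
move=> P0 PA PM.
have s0 : 0 <= \prod_k shell_bound (o k).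
  by apply: prodr_ge0 => k _; exact: powR_ge0.
rewrite -(@ler_pXn2r _ (d * n)) ?nnegrE// exprM -[in leLHS](card_ord n) -prodr_const -prodrXl.
apply: ler_prod => k _; rewrite exprn_ge0//= powR_invn_Xn ?(ltW (min_shell_gt0 _))//.
by rewrite le_min PA ler_pdivlMr ?exprn_gt0//=; exact: PM.
Qed.

Section Boxes.
Variables (J : finType) (M : J -> 'M[R]_n.+1).

(* The coordinate 0 serves as unit of length: only the other ones carry an
   exponent. *)
Definition offset (o : 'I_n -> nat) (k : 'I_n.+1) : nat :=
  if unlift ord0 k is Some k' then o k' else 0.

(** The scale t for which the product of the bounds t 2^(o_k), divided by the determinant, equals
    the product of the shell bounds. *)
Definition shell_scale (j : J) (o : 'I_n -> nat) : R :=
  ((\prod_k shell_bound (o k)) * `|\det (M j)| / 2 ^+ (\sum_k offset o k)) `^ n.+1%:R^-1.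

(** The factor 2 makes up for rounding the ratios of the [b k] down to powers of 2. *)
Definition shell_box (j : J) (o : 'I_n -> nat) : set (n.+1.-tuple mR) :=
  if \det (M j) == 0 then set0 else
  parallelepiped (M j) (fun k => 2 * shell_scale j o * 2 ^+ offset o k).

Lemma measurable_shell_box j o : measurable (shell_box j o).
Proof.
by rewrite /shell_box; case: ifP => _ //; exact: measurable_parallelepiped.
Qed.

Lemma volume_shell_box j o :
  (lebesgue_tuple R n.+1 (shell_box j o) <= (4 ^+ n.+1 * \prod_k shell_bound (o k))%:E)%E.
Proof.
have s0 : 0 <= \prod_k shell_bound (o k).
  by apply: prodr_ge0 => k _; exact: powR_ge0.
rewrite /shell_box; case: eqVneq => [_|dM].
  by rewrite measure0 lee_fin mulr_ge0// exprn_ge0.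
rewrite volume_parallelepiped ?unitmxE ?unitfE// => [|k]; last first.
  by rewrite !mulr_ge0 ?powR_ge0// exprn_ge0.
rewrite lee_fin (eq_bigr (fun k => (4 * shell_scale j o) * 2 ^+ offset o k)); last first.
  by move=> k _; ring.
rewrite big_split /= prodr_const card_ord -expr_sum exprMn powR_invn_Xn//; last first.
  by rewrite !mulr_ge0// invr_ge0 exprn_ge0.
rewrite le_eqVlt; apply/orP; left; apply/eqP; field.
by rewrite expf_neq0//= normr_eq0.
Qed.

(** The boxes with offsets below [N] have total volume bounded independently of [N]; continuity from
    below then admits all offsets. *)
Theorem covering_volume (D Z : set (n.+1.-tuple mR)) :
  measurable D -> measurable Z -> lebesgue_tuple R n.+1 Z = 0%E ->
  (forall x, D x -> ~ Z x -> exists (j : J) (b : 'I_n.+1 -> R),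
     [/\ \det (M j) != 0, forall k, 0 < b ord0 <= b k,
      forall k, `|\sum_q M j k q * tnth x q| <= b k &
      let P := (\prod_k b k) / `|\det (M j)| in
      P ^+ d <= A0 /\ forall k, P ^+ d * (b k / b ord0) <= M0]) ->
  (lebesgue_tuple R n.+1 D <= (#|J|%:R * 4 ^+ n.+1 * A0 `^ d%:R^-1 *
     (w%:R + (1 - shell_ratio)^-1) ^+ n)%:E)%E.
Proof.
move=> mD mZ Z0 DP; set bound := (_ * _ * _ * _)%R.
pose E N : set (n.+1.-tuple mR) :=
  \bigcup_(jo : J * {ffun 'I_n -> 'I_N}) shell_box jo.1 (fun k => jo.2 k).
have mE N : measurable (E N).
  by apply: measurable_fin_union => jo; exact: measurable_shell_box.
have muE N : (lebesgue_tuple R n.+1 (E N) <= bound%:E)%E.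
  apply: le_trans (measure_fin_union_le _ _) _.
    by move=> jo; exact: measurable_shell_box.
  apply: (@le_trans _ _ (\sum_(jo : J * {ffun 'I_n -> 'I_N})
      (4 ^+ n.+1 * \prod_k shell_bound (jo.2 k))%:E)%E).
    by apply: lee_sum => jo _; exact: volume_shell_box.
  rewrite sumEFin lee_fin.
  rewrite -(pair_bigA _ (fun (j : J) (o : {ffun 'I_n -> 'I_N}) =>
     4 ^+ n.+1 * \prod_k shell_bound (o k))) /=.
  rewrite sumr_const -mulr_sumr -[leLHS]mulr_natl mulrA /bound -[leRHS]mulrA.
  rewrite ler_wpM2l ?mulr_ge0 ?exprn_ge0//.
  (* The sum over the families of offsets factors into [n] equal sums. *)
  rewrite -(bigA_distr_bigA (fun (_ : 'I_n) (o : 'I_N) => shell_bound o)).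
  rewrite prodr_const card_ord.
  have -> : A0 `^ d%:R^-1 = (A0 `^ (d * n)%:R^-1) ^+ n.
    rewrite -powR_mulrn ?powR_ge0// -powRrM natrM; congr (_ `^ _); field.
    by rewrite !pnatr_eq0 -!lt0n n0.
  rewrite -exprMn lerXn2r ?nnegrE ?sum_shell_bound_le//.
    by apply: sumr_ge0 => o _; exact: powR_ge0.
  by rewrite mulr_ge0 ?powR_ge0// addr_ge0// invr_ge0 subr_ge0 ltW// shell_ratio_lt1.
have ndE : nondecreasing_seq E.
  move=> N N' NN'; apply/subsetPset => x [[j o] _ /= xo].
  by exists (j, [ffun k => widen_ord NN' (o k)]) => //=; under eq_fun do rewrite ffunE.
have DZE : D `<=` Z `|` \bigcup_N E N.
  move=> x Dx; have [Zx|nZx] := pselect (Z x); [by left|right].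
  have [j [b [dM b0 bx [PA PM]]]] := DP x Dx nZx.
  set P := _ / _ in PA PM.
  have bk k : 0 < b k by have /andP[h1 h2] := b0 k; exact: lt_le_trans h1 h2.
  have P0 : 0 < P by rewrite divr_gt0 ?normr_gt0// prodr_gt0.
  (* [2 ^+ o k] is the largest power of 2 not exceeding the ratio to [b ord0]. *)
  have /choice[ o oP] (k : 'I_n) : exists o, 2 ^+ o <= b (lift ord0 k) / b ord0 < 2 ^+ o.+1.
    have : 1 <= b (lift ord0 k) / b ord0.
      by rewrite ler_pdivlMr// mul1r; have /andP[] := b0 (lift ord0 k).
    move: (_ / _) => r r1.
    have ex : exists m, r < 2 ^+ m.
      exists (Num.trunc r).+1; apply: lt_trans (truncnS_gt r) _.
      by rewrite -natrX ltr_nat ltn_expl.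
    case: (ex_minnP ex) => -[|m] rm mmin.
      by move: rm; rewrite expr0 ltNge r1.
    by exists m; rewrite rm andbT leNgt; apply/negP => /mmin; rewrite ltnn.
  pose N := (\max_k o k).+1.
  have oN k : (o k < N)%N by rewrite ltnS leq_bigmax.
  exists N => //; exists (j, [ffun k => Ordinal (oN k)]) => //=.
  rewrite (_ : (fun k => _) = o); last by apply/funext => k; rewrite ffunE.
  rewrite /shell_box (negPf dM) => k; apply: (le_trans (bx k)).
  have bo q : b ord0 * 2 ^+ offset o q <= b q <= 2 * b ord0 * 2 ^+ offset o q.
    rewrite /offset; case: unliftP => [q' ->|->]; last first.
      by rewrite expr0 !mulr1 lexx /=; have := bk ord0; lra.
    have /andP[h1 /ltW h2] := oP q'.
    move: h1 h2; rewrite ler_pdivlMr// ler_pdivrMr// exprS => h1 h2.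
    by apply/andP; split; [rewrite mulrC|rewrite mulrAC].
  have /andP[_ h] := bo k; apply: (le_trans h).
  rewrite ler_pM2r ?exprn_gt0// ler_pM2l//.
  (* That [b ord0] is at most the scale of the box is seen on [n.+1]-st powers, as the product of
     the [b k] is P times the determinant. *)
  have bS : b ord0 ^+ n.+1 <= (\prod_k shell_bound (o k)) * `|\det (M j)| / 2 ^+ (\sum_k offset o k).
    rewrite ler_pdivlMr ?exprn_gt0//.
    apply: (@le_trans _ _ (\prod_k b k)).
      have -> : b ord0 ^+ n.+1 = \prod_(k < n.+1) b ord0 by rewrite prodr_const card_ord.
      rewrite expr_sum -big_split /=.
      by apply: ler_prod => q _; rewrite mulr_ge0 ?(ltW (bk _)) ?exprn_ge0//=; have /andP[] := bo q.
    rewrite -ler_pdivrMr ?normr_gt0//; apply: le_prod_shell_bound => //; first exact: ltW.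
    move=> q; apply: le_trans (PM (lift ord0 q)); rewrite ler_pM2l ?exprn_gt0//.
    by have /andP[] := oP q.
  rewrite -(@ler_pXn2r _ n.+1) ?nnegrE ?powR_ge0 ?(ltW (bk _))// powR_invn_Xn//.
  exact: le_trans (exprn_ge0 _ (ltW (bk _))) bS.
have mUE : measurable (\bigcup_N E N) by exact: bigcup_measurable.
apply: (@le_trans _ _ (lebesgue_tuple R n.+1 (Z `|` \bigcup_N E N))).
  by apply: le_measure; rewrite ?inE//; exact: measurableU.
apply: le_trans (measureU2 _ _ _) _ => //.
rewrite [X in (X + _)%E]Z0 add0e.
have cvE := nondecreasing_cvg_mu (mu := lebesgue_tuple R n.+1) mE mUE ndE.
rewrite -[leLHS](cvg_lim _ cvE)//; apply: lime_le; first by apply/cvg_ex; eexists; exact: cvE.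
by near=> N; exact: muE.
Unshelve. all: by end_near. Qed.

End Boxes.
End Covering.

(** * The volume bound *)

Section PolynomialGrowth.
Variable R : realType.

(** The exponent may be arbitrary, since only the logarithm of such a bound enters. Nonnegativity is
    included so that bounds can be multiplied. *)
Definition poly_growth (f : R -> R) := exists (c : R) (e : nat), 1 <= c /\
  forall y, 1 <= y -> 0 <= f y <= c * y ^+ e.

Lemma poly_growth_cst a : 0 <= a -> poly_growth (fun=> a).
Proof.
move=> a0; exists (1 + a), 0%N; split; first by rewrite lerDl.
by move=> y _; rewrite expr0 mulr1 a0 lerDr ler01.
Qed.

Lemma poly_growth_id : poly_growth id.
Proof.
by exists 1, 1%N; split => // y y1; rewrite expr1 mul1r lexx (le_trans ler01).
Qed.

Lemma poly_growthM f g : poly_growth f -> poly_growth g ->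
  poly_growth (fun y => f y * g y).
Proof.
move=> [c [e [c1 fP]]] [c' [e' [c1' gP]]]; exists (c * c'), (e + e')%N.
split=> [|y y1]; first by rewrite -[leLHS]mulr1 ler_pM.
have /andP[f0 f1] := fP y y1; have /andP[g0 g1] := gP y y1.
by rewrite mulr_ge0//= exprD mulrACA ler_pM.
Qed.

Lemma poly_growthD f g : poly_growth f -> poly_growth g ->
  poly_growth (fun y => f y + g y).
Proof.
move=> [c [e [c1 fP]]] [c' [e' [c1' gP]]]; exists (c + c'), (e + e')%N.
split=> [|y y1]; first by rewrite (le_trans c1)// lerDl (le_trans ler01).
have /andP[f0 f1] := fP y y1; have /andP[g0 g1] := gP y y1.
rewrite addr_ge0//= mulrDl; apply: lerD.
  apply: (le_trans f1); rewrite ler_wpM2l ?(le_trans ler01)//.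
  by apply: ler_weXn2l => //; exact: leq_addr.
apply: (le_trans g1); rewrite ler_wpM2l ?(le_trans ler01)//.
by apply: ler_weXn2l => //; exact: leq_addl.
Qed.

Lemma poly_growthX f k : poly_growth f -> poly_growth (fun y => f y ^+ k).
Proof.
move=> fP; elim: k => [|k IH].
  by under eq_fun do rewrite expr0; exact: poly_growth_cst.
by under eq_fun do rewrite exprS; exact: poly_growthM.
Qed.

(** [w] is the rounded logarithm to base 2; for small [m] as well as large, ln (1 + 2m) is at most
    ln 3 + |ln m|. *)
Lemma log_bound (c : R) (e : nat) : 1 <= c -> exists K : R, 1 <= K /\
  forall m, 0 < m -> exists w : nat,
    c * (1 + 2 * m) ^+ e <= 2 ^+ w /\ w%:R <= K * (1 + `|ln m|).
Proof.
move=> c1; have c0 : 0 < c by exact: lt_le_trans c1.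
have l2 : 0 < ln 2 :> R by rewrite ln_gt0// ltr1n.
have l3 : 0 <= ln 3 :> R by rewrite ln_ge0// ler1n.
have lc : 0 <= ln c by rewrite ln_ge0.
pose a := ln c + e%:R * (ln 3 + 1).
have a0 : 0 <= a by rewrite addr_ge0// mulr_ge0// addr_ge0.
exists (a / ln 2 + 1); split; first by rewrite lerDr divr_ge0// ltW.
move=> m m0; pose y := 1 + 2 * m.
have y1 : 1 <= y by rewrite lerDl mulr_ge0// ltW.
have y0 : 0 < y by exact: lt_le_trans y1.
have ly : ln y <= ln 3 + `|ln m|.
  have [m1|m1] := leP m 1.
    apply: (@le_trans _ _ (ln 3)); last by rewrite lerDl.
    by rewrite ler_ln ?posrE//; rewrite /y; lra.
  apply: (@le_trans _ _ (ln (3 * m))).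
    by rewrite ler_ln ?posrE ?mulr_gt0//; rewrite /y; lra.
  by rewrite lnM ?posrE// lerD2l ler_norm.
pose r := (ln c + e%:R * ln y) / ln 2.
have r0 : 0 <= r by rewrite divr_ge0 ?(ltW l2)// addr_ge0// mulr_ge0// ln_ge0.
exists (Num.trunc r).+1; split.
  rewrite -/y -ler_ln ?posrE ?mulr_gt0 ?exprn_gt0// lnM ?posrE ?exprn_gt0// !lnXn//.
  rewrite -[_ *+ e]mulr_natl -[_ *+ _.+1]mulr_natl -ler_pdivrMr//.
  by rewrite ltW// truncnS_gt.
rewrite -natr1; apply: (@le_trans _ _ (r + 1)); first by rewrite lerD2r truncn_le.
have ra : r <= a * (1 + `|ln m|) / ln 2.
  rewrite /r ler_pM2r ?invr_gt0// /a mulrDl; apply: lerD.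
    by rewrite ler_peMr// lerDl.
  rewrite -mulrA ler_wpM2l//; apply: (le_trans ly).
  have := normr_ge0 (ln m); nra.
rewrite mulrDl mul1r; apply: lerD; first by rewrite mulrAC.
by rewrite lerDl.
Qed.

End PolynomialGrowth.

Section FormBounds.
Variable R : realType.
Local Notation C := (R[i]).
Local Notation nc := (@Normc.normc R).

Lemma normc_le_hermitian n (v : 'rV[C]_n) k : nc (v 0 k) <= hermitian_norm v.
Proof.
rewrite -[leLHS]ger0_norm ?normc_ge0// -sqrtr_sqr ler_sqrt; last first.
  by apply: sumr_ge0 => i _; exact: sqr_ge0.
rewrite (bigD1 k)//= lerDl; apply: sumr_ge0 => i _; exact: sqr_ge0.
Qed.

Lemma eval_form_le n (v : 'rV[C]_n) (x : 'I_n -> R) :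
  nc (eval_form v x) <= hermitian_norm v * \sum_k `|x k|.
Proof.
apply: le_trans (normc_sum_le _ _) _; rewrite mulr_sumr; apply: ler_sum => k _.
by rewrite Normc.normcM normc_real ler_wpM2r// normc_le_hermitian.
Qed.

Lemma eval_form_mulmx n (v : 'rV[C]_n) (T : 'M[R]_n) (x : 'I_n -> R) :
  T \in unitmx ->
  eval_form v x = eval_form (v *m map_mx (real_complex R) T)
    (fun i => \sum_j invmx T i j * x j).
Proof.
move=> uT.
pose X : 'cV[R]_n := \col_k x k.
have evE u (y : 'I_n -> R) : eval_form u y =
    (u *m map_mx (real_complex R) (\col_k y k)) 0 0.
  by rewrite mxE; apply: eq_bigr => k _; rewrite !mxE.
rewrite !evE -mulmxA -map_mxM; congr ((_ *m map_mx _ _) 0 0).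
rewrite (_ : (\col_k \sum_j invmx T k j * x j) = invmx T *m X); first by rewrite mulKVmx.
by apply/matrixP => i j; rewrite !mxE; apply: eq_bigr => k _; rewrite mxE.
Qed.

Lemma det_le n (A : 'M[R]_n) (r : R) : (forall i j, `|A i j| <= r) ->
  `|\det A| <= #|perm_of 'I_n|%:R * r ^+ n.
Proof.
move=> Ar; apply: le_trans (ler_norm_sum _ _ _) _.
rewrite mulr_natl -sumr_const; apply: ler_sum => s _.
rewrite normrM normr_sign mul1r normr_prod -[in leRHS](card_ord n) -prodr_const.
by apply: ler_prod => i _; rewrite normr_ge0 Ar.
Qed.

Lemma real_part_le_eval n (v : 'rV[C]_n) e (x : 'I_n -> R) :
  `|\sum_q real_part v e 0 q * x q| <= nc (eval_form v x).
Proof.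
rewrite nc_eval_form -sqrtr_sqr ler_sqrt ?addr_ge0 ?sqr_ge0//.
by case: e; rewrite ?lerDl ?lerDr sqr_ge0.
Qed.

Lemma real_part_neq0 n (v : 'rV[C]_n) : v != 0 -> exists e, real_part v e != 0.
Proof.
move=> v0; apply: contrapT => ne; case/eqP: v0; apply/rowP => k; rewrite mxE.
have E e : real_part v e 0 k = 0.
  have /eqP -> : real_part v e == 0 by apply/negPn/negP => h; apply: ne; exists e.
  by rewrite mxE.
by have := E true; have := E false; rewrite !mxE; case: (v 0 k) => ? ? /= -> ->.
Qed.

End FormBounds.

Section Main.
Variable R : realType.
Local Notation C := (R[i]).
Local Notation nc := (@Normc.normc R).

(** The bound of [independent_lattice_vectors] for [lam = y^-1], whose last term [lam] is replaced
    with 1. *)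
Definition lattice_radius n (y : R) : R := 5 ^+ n.+1 * (4 * n.+1%:R * y) ^+ n + 1.

Definition pencil_bound n d (y : R) : R := y * (2 * lattice_radius n y) ^+ d.

Definition kappa_bound n d (y : R) : R :=
  (2 * pencil_bound n d y) ^+ n.+1 * (#|perm_of 'I_n.+1|%:R * lattice_radius n y ^+ n.+1).

(** Bounds [P ^+ d] times the ratio of two members of the tuple. The first factor comes from the
    lower bound on the nonzero coordinates, the second one from that on the determinant in P. *)
Definition far_bound n d (y : R) : R :=
  let b := liouville_bound n.+1 d (pencil_bound n d y) in
  let N := liouville_size n.+1 d in
  (b ^+ N.+1) ^+ (d * n.+1) * (kappa_bound n d y * b ^+ N) ^+ d.

(** The additional [y ^+ n.+1] pays for the denominator [m ^+ n.+1] of [A0]. *)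
Lemma far_bound_growth n d : poly_growth (fun y : R => far_bound n d y * y ^+ n.+1).
Proof.
have rg : poly_growth (@lattice_radius n).
  apply: poly_growthD; last exact: poly_growth_cst.
  apply: poly_growthM; first by apply: poly_growth_cst; exact: exprn_ge0.
  apply: poly_growthX; apply: poly_growthM; last exact: poly_growth_id.
  by apply: poly_growth_cst; exact: mulr_ge0.
have pg : poly_growth (@pencil_bound n d).
  apply: poly_growthM; first exact: poly_growth_id.
  by apply: poly_growthX; apply: poly_growthM => //; exact: poly_growth_cst.
have kg : poly_growth (@kappa_bound n d).
  apply: poly_growthM.
    by apply: poly_growthX; apply: poly_growthM => //; exact: poly_growth_cst.
  by apply: poly_growthM; [exact: poly_growth_cst|exact: poly_growthX].
have bg : poly_growth (fun y => liouville_bound n.+1 d (pencil_bound n d y)).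
  apply: poly_growthM; first exact: poly_growth_cst.
  apply: poly_growthX; apply: poly_growthM; first exact: poly_growth_cst.
  by apply: poly_growthM; [exact: poly_growth_cst|exact: poly_growthX].
apply: poly_growthM; last by apply: poly_growthX; exact: poly_growth_id.
apply: poly_growthM; first by do 2!apply: poly_growthX.
by apply: poly_growthX; apply: poly_growthM => //; exact: poly_growthX.
Qed.

Variables (n d : nat) (n0 : (0 < n)%N) (F : {mpoly int[n.+1]}).
Let FR : {mpoly R[n.+1]} := map_mpoly intr F.
Variable L : 'I_d.+1 -> 'rV[C]_n.+1.
Hypotheses (FL : is_factorization FR L)
  (Vfin : (form_volume FR < +oo)%E)
  (nz : forall x : 'rV[rat]_n.+1, x != 0 -> meval (x 0) (map_mpoly intr F) != 0).

Let m := min_height d.+1 FR.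
Let b (z : 'I_n.+1 -> int) j := \sum_i L j 0 i * (z i)%:~R.

Lemma height_comp (T : 'M[R]_n.+1) : `|\det T| = 1 ->
  height d.+1 (form_comp FR T) =
  \prod_j hermitian_norm (L j *m map_mx (real_complex R) T).
Proof.
move=> dT; apply: heightE; apply: factorization_comp => //.
by rewrite unitmxE unitfE -normr_gt0 dT.
Qed.

(** The product is the absolute value of F at [z], an integer, which is not 0 because F has no
    nontrivial rational zero. *)
Lemma form_at_integer_point (z : 'rV[int]_n.+1) : z != 0 -> 1 <= \prod_j nc (b (z 0) j).
Proof.
move=> z0; rewrite -normc_prod.
have -> : \prod_j b (z 0) j = (meval (z 0) F)%:~R.
  have := factorization_meval (fun i => (z 0 i)%:~R) FL.
  have -> : meval (fun i => (z 0 i)%:~R) FR = (meval (z 0) F)%:~R.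
    by rewrite (rmorph_meval intr).
  rewrite [LHS](rmorph_int (real_complex R)) => ->.
  apply: eq_bigr => j _; apply: eq_bigr => i _; congr (_ * _).
  by rewrite [RHS](rmorph_int (real_complex R)).
rewrite normc_int -intr_norm ler1z -gtz0_ge1 normr_gt0.
apply: contraNneq (nz (x := map_mx intr z) _) => [Fz|]; last first.
  by apply: contra z0 => /eqP/rowP h; apply/eqP/rowP => i; have := h i; rewrite !mxE => /eqP; rewrite intr_eq0 => /eqP.
have -> : meval ((map_mx intr z : 'rV[rat]_n.+1) 0) (map_mpoly intr F) = (meval (z 0) F)%:~R.
  by rewrite (rmorph_meval intr); apply: meval_eq => i; rewrite mxE.
by rewrite Fz.
Qed.

Lemma integer_point_le (T : 'M[R]_n.+1) (z : 'I_n.+1 -> int) j : `|\det T| = 1 ->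
  nc (b z j) <= hermitian_norm (L j *m map_mx (real_complex R) T) *
    \sum_i `|\sum_k invmx T i k * (z k)%:~R|.
Proof.
move=> dT; have uT : T \in unitmx by rewrite unitmxE unitfE -normr_gt0 dT.
have -> : b z j = eval_form (L j) (fun k => (z k)%:~R).
  by apply: eq_bigr => i _; congr (_ * _); rewrite [RHS](rmorph_int (real_complex R)).
by rewrite (eval_form_mulmx _ _ uT); exact: eval_form_le.
Qed.

Lemma integer_point_height (T : 'M[R]_n.+1) (z : 'rV[int]_n.+1) : `|\det T| = 1 -> z != 0 ->
  1 <= height d.+1 (form_comp FR T) *
    (\sum_i `|\sum_k invmx T i k * (z 0 k)%:~R|) ^+ d.+1.
Proof.
move=> dT z0; apply: le_trans (form_at_integer_point z0) _.
set s := \sum_i _.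
have -> : s ^+ d.+1 = \prod_(j < d.+1) s by rewrite prodr_const card_ord.
rewrite height_comp// -big_split /=.
by apply: ler_prod => j _; rewrite normc_ge0 integer_point_le.
Qed.

(** Minkowski's theorem, with 5 beating the constant 4, gives a nonzero integer point with small
    coordinates with respect to [T], at which |F| is at least 1. *)
Lemma height_lower (T : 'M[R]_n.+1) : `|\det T| = 1 ->
  ((5 * n.+1%:R) ^+ d.+1)^-1 <= height d.+1 (form_comp FR T).
Proof.
move=> dT; have uT : T \in unitmx by rewrite unitmxE unitfE -normr_gt0 dT.
have [|//||z [z0 zc]] := @weak_minkowski R n.+1 (invmx T) (fun=> 5).
- by rewrite unitmx_inv.
- by rewrite det_inv normfV dT invr1 mulr1 prodr_const card_ord ltrXn2r// ltr_nat.
have H0 : 0 <= height d.+1 (form_comp FR T).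
  by rewrite height_comp// prodr_ge0// => j _; exact: hermitian_norm_ge0.
rewrite -[leLHS]mul1r ler_pdivrMr ?exprn_gt0 ?mulr_gt0//.
apply: le_trans (integer_point_height dT z0) _; rewrite ler_wpM2l// lerXn2r ?nnegrE//.
  exact: sumr_ge0.
apply: (@le_trans _ _ (\sum_(i < n.+1) 5)); first exact: ler_sum.
by rewrite sumr_const card_ord mulr_natr.
Qed.

Let heights := [set height d.+1 (form_comp FR T) | T in [set T : 'M[R]_n.+1 | `|\det T| = 1]].

Lemma has_inf_heights : has_inf heights.
Proof.
split; first by exists (height d.+1 (form_comp FR 1%:M)), 1%:M => //=; rewrite det1 normr1.
by exists ((5 * n.+1%:R) ^+ d.+1)^-1 => _ [T /= dT <-]; exact: height_lower.
Qed.

Lemma min_height_gt0 : 0 < m.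
Proof.
apply: (@lt_le_trans _ _ ((5 * n.+1%:R) ^+ d.+1)^-1).
  by rewrite invr_gt0 exprn_gt0// mulr_gt0.
apply: lb_le_inf; first exact: has_inf_heights.1.
by move=> _ [T /= dT <-]; exact: height_lower.
Qed.

Lemma min_height_le (T : 'M[R]_n.+1) : `|\det T| = 1 ->
  m <= \prod_j hermitian_norm (L j *m map_mx (real_complex R) T).
Proof.
by move=> dT; rewrite -height_comp//; apply: ge_inf; [exact: has_inf_heights.2|exists T].
Qed.

Lemma form_volumeE (alpha : R) (l : 'I_d.+1 -> 'rV[C]_n.+1) : 0 < alpha ->
  (forall x, `|meval x FR| = alpha * \prod_j nc (eval_form (l j) x)) ->
  [set x : n.+1.-tuple R | `|meval (tnth x) FR| <= 1] = form_body l alpha^-1.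
Proof.
move=> a0 FE; apply/seteqP; split => x /=; rewrite FE.
  by rewrite -ler_pdivlMl// mulr1.
by rewrite -ler_pdivlMl// mulr1.
Qed.

Lemma stable_of_finite_volume (alpha : R) (l : 'I_d.+1 -> 'rV[C]_n.+1) : 0 < alpha ->
  (forall x, `|meval x FR| = alpha * \prod_j nc (eval_form (l j) x)) -> stable l.
Proof.
move=> a0 FE T Cf S uT lC S0 S0'; rewrite ltnNge; apply/negP => h.
move: Vfin; rewrite /form_volume (form_volumeE a0 FE).
by rewrite (infinite_volume _ uT lC S0 S0' _ h) ?invr_gt0// ltxx.
Qed.

Let y := 1 + 2 * m.
(** The bound for [P ^+ d.+1] resulting from [tuple_volume_le_height]. *)
Let A0 := (2 * n.+1%:R) ^+ (d.+1 * n.+1) / m ^+ n.+1.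

(* Here [y] bounds the height of [F] composed with a nearly optimal [T], and
   1 / y bounds below the length of the nonzero vectors of T^-1 Z^n. *)
Lemma normal_position : exists B : 'M[int]_n.+1,
  [/\ \det (map_mx intr B : 'M[R]_n.+1) != 0,
    `|\det (map_mx intr B : 'M[R]_n.+1)| <=
      #|perm_of 'I_n.+1|%:R * lattice_radius n y ^+ n.+1,
    forall k, \prod_j (nc (b (B ord0) j) + nc (b (B k) j)) <= pencil_bound n d.+1 y &
    1 <= \prod_j nc (b (B ord0) j)].
Proof.
have m0 := min_height_gt0.
have [H [T /= dT HE] Hm] := inf_adherent m0 has_inf_heights.
have {}Hm : H < 2 * m by move: Hm; rewrite -/m -/(min_height _ _) -/FR -/m; lra.
have uT : T \in unitmx by rewrite unitmxE unitfE -normr_gt0 dT.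
have dS : `|\det (invmx T)| = 1 by rewrite det_inv normfV dT invr1.
have y0 : 0 < y by rewrite /y; lra.
have y1 : 1 <= y by rewrite /y; lra.
have lamP (z : 'rV[int]_n.+1) : z != 0 ->
    y^-1 <= \sum_i `|\sum_j invmx T i j * (z 0 j)%:~R|.
  move=> z0; have := integer_point_height dT z0; rewrite HE.
  set s := \sum_i _ => h; rewrite leNgt; apply/negP => sy.
  have s0 : 0 <= s by exact: sumr_ge0.
  have s1 : s <= 1 by rewrite (le_trans (ltW sy))// invf_le1.
  have h2 : H * s ^+ d.+1 <= 2 * m * s.
    apply: (@le_trans _ _ (2 * m * s ^+ d.+1)).
      by rewrite ler_wpM2r ?exprn_ge0// ltW.
    rewrite ler_wpM2l ?mulr_ge0 ?(ltW m0)// exprS ler_piMr// exprn_ile1//.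
  have h3 : y * s < 1 by rewrite mulrC -ltr_pdivlMr// div1r.
  have := le_trans h h2; move: h3; rewrite /y; lra.
have yV0 : 0 < y^-1 by rewrite invr_gt0.
have [B [dB Bk]] := independent_lattice_vectors (ltn0Sn n) dS yV0 lamP.
have rB k : \sum_i `|\sum_j invmx T i j * (B k j)%:~R| <= lattice_radius n y.
  apply: le_trans (Bk k) _; rewrite subn1 invrK /lattice_radius lerD2l.
  by rewrite invf_le1.
exists B; split => //.
(* The images of the rows of [B] under T^-1, unlike the rows themselves, have bounded entries. *)
- have -> : `|\det (map_mx intr B : 'M[R]_n.+1)| =
      `|\det ((map_mx intr B : 'M[R]_n.+1) *m (invmx T)^T)|.
    by rewrite det_mulmx det_tr normrM dS mulr1.
  apply: det_le => k i; apply: le_trans (rB k); rewrite (bigD1 i)//=.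
  apply: ler_wpDr; first exact: sumr_ge0.
  rewrite le_eqVlt; apply/orP; left; apply/eqP; congr (`|_|); rewrite mxE.
  by apply: eq_bigr => j _; rewrite !mxE mulrC.
- move=> k; pose h j := hermitian_norm (L j *m map_mx (real_complex R) T).
  have h0 j : 0 <= h j by exact: hermitian_norm_ge0.
  have bh k' j : nc (b (B k') j) <= h j * lattice_radius n y.
    apply: le_trans (integer_point_le _ _ dT) _.
    exact: ler_wpM2l (h0 j) _ _ (rB k').
  apply: (@le_trans _ _ (\prod_j (h j * (2 * lattice_radius n y)))).
    apply: ler_prod => j _; rewrite addr_ge0 ?normc_ge0//=.
    by have := bh k j; have := bh ord0 j; lra.
  rewrite big_split /= prodr_const card_ord /pencil_bound -height_comp// HE.
  rewrite ler_wpM2r//.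
    rewrite exprn_ge0// mulr_ge0// (le_trans _ (rB k))//; exact: sumr_ge0.
  by rewrite /y; lra.
- have r0 : row ord0 B != 0.
    apply: contraNneq dB => r0; rewrite (expand_det_row _ ord0) big1// => j _.
    by have /rowP/(_ j) := r0; rewrite !mxE => ->; rewrite mul0r.
  apply: le_trans (form_at_integer_point r0) _; rewrite le_eqVlt; apply/orP; left.
  apply/eqP; apply: eq_bigr => j _; congr nc; apply: eq_bigr => i _.
  by rewrite mxE.
Qed.

Lemma volume_le (w : nat) : far_bound n d.+1 y * y ^+ n.+1 <= 2 ^+ w ->
  (form_volume FR <= (#|{ffun 'I_n.+1 -> 'I_d.+1 * bool}|%:R * 4 ^+ n.+1 *
     A0 `^ d.+1%:R^-1 * (w%:R + (1 - shell_ratio R n d.+1)^-1) ^+ n)%:E)%E.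
Proof.
move=> wP; have m0 := min_height_gt0.
have y0 : 0 < y by rewrite /y; lra.
have y1 : 1 <= y by rewrite /y; lra.
have [B [dB dBle bQ b1]] := normal_position.
set Q := pencil_bound n d.+1 y in bQ.
(* The absolute value of F at the first row of [B], split off when the forms are normalized to the
   value 1 there. *)
pose al := \prod_j nc (b (B ord0) j).
have al0 : 0 < al by exact: lt_le_trans ltr01 b1.
have b0 j : b (B ord0) j != 0.
  by have := al0; rewrite lt0r => /andP[/prodf_neq0/(_ j isT)]; rewrite normc_eq0.
have Q1 : 1 <= Q.
  apply: le_trans (bQ ord0); apply: (le_trans b1); apply: ler_prod => j _.
  by rewrite normc_ge0 lerDl normc_ge0.
have [kappa [kap0 [kapB kapI]]] := liouville FL b0 dB Q1 bQ.
set l := fun j => _ *: L j in kapI.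
have Ll j : L j = b (B ord0) j *: l j.
  by rewrite /l scalerA divff ?scale1r.
have l0 j : l j != 0.
  by rewrite scaler_eq0 negb_or invr_eq0 b0 FL.1.
have FE x : `|meval x FR| = al * \prod_j nc (eval_form (l j) x).
  rewrite -normc_real (factorization_meval _ FL) normc_prod -big_split /=.
  apply: eq_bigr => j _; rewrite -Normc.normcM; congr nc.
  rewrite /eval_form mulr_sumr; apply: eq_bigr => i _.
  by rewrite mulrA; congr (_ * _); rewrite {1}Ll mxE.
have st := stable_of_finite_volume al0 FE.
set LB := liouville_bound n.+1 d.+1 Q in kapI.
set G := LB ^+ liouville_size n.+1 d.+1 in kapI.
have LB1 : 1 <= LB.
  rewrite -[leLHS]mulr1 ler_pM//.
    by rewrite ler1n; apply/card_gt0P; exists 1%g.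
  by rewrite exprn_ege1// -[leLHS]mulr1 ler_pM ?ler1n// -[leLHS]mulr1 ler_pM ?ler1n ?exprn_ege1.
have LB0 : 0 < LB by exact: lt_le_trans LB1.
have G0 : 0 < G by exact: exprn_gt0.
have kapK : kappa <= kappa_bound n d.+1 y.
  by apply: (le_trans kapB); rewrite ler_wpM2l// exprn_ge0// mulr_ge0// (le_trans ler01).
have K0 : 0 < kappa_bound n d.+1 y by exact: lt_le_trans kapK.
rewrite /form_volume (form_volumeE al0 FE).
have /choice[ee eeP] j := real_part_neq0 (l0 j).
(* A null set outside which no [l j] vanishes: one nonzero real or imaginary part of each
   suffices. *)
pose Z := \bigcup_(j : 'I_d.+1) [set x : n.+1.-tuple (measurableTypeR R) |
  \sum_k real_part (l j) (ee j) 0 k * tnth x k = 0].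
have mZ j : measurable [set x : n.+1.-tuple (measurableTypeR R) |
    \sum_k real_part (l j) (ee j) 0 k * tnth x k = 0].
  have := @measurable_linear_form R n.+1 (real_part (l j) (ee j) 0) measurableT _
    (measurable_set1 0).
  by rewrite setTI.
have muZ : lebesgue_tuple R n.+1 Z = 0%E.
  apply/eqP; rewrite eq_le measure_ge0 andbT.
  apply: le_trans (measure_fin_union_le _ mZ) _.
  by rewrite big1// => j _; exact: volume_hyperplane.
apply: (@covering_volume R n d.+1 w A0 (far_bound n d.+1 y) n0 (ltn0Sn d) _ _ _
  {ffun 'I_n.+1 -> 'I_d.+1 * bool} (fun I => real_parts_mx l I) _ Z).
- by rewrite divr_gt0 ?exprn_gt0// mulr_gt0.
- by apply: mulr_gt0; [exact/exprn_gt0/exprn_gt0|exact/exprn_gt0/mulr_gt0].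
- apply: (@le_trans _ _ (2 ^+ w / y ^+ n.+1)).
    by rewrite ler_pdivlMr ?exprn_gt0.
  rewrite mulrC ler_wpM2r ?exprn_ge0// /A0 -[leLHS]mul1r ler_pM ?invr_ge0 ?exprn_ge0 ?(ltW y0)//.
    by rewrite exprn_ege1// -natrM ler1n.
  by rewrite lef_pV2 ?posrE ?exprn_gt0// lerXn2r ?nnegrE ?(ltW y0) ?(ltW m0)// /y; lra.
- exact: measurable_form_body.
- exact: measurable_fin_union.
- exact: muZ.
move=> x Dx nZx.
pose X j := nc (eval_form (l j) (tnth x)).
have X0 j : 0 < X j.
  rewrite lt0r normc_ge0 andbT; apply/eqP => Xj; apply: nZx; exists j => //=.
  by apply/normr0_eq0/le_anti; rewrite normr_ge0 andbT -[leRHS]Xj real_part_le_eval.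
have alX : al * \prod_j X j <= 1.
  by rewrite -ler_pdivlMl// mulr1; exact: Dx.
have X1 : \prod_j X j <= 1.
  by apply: le_trans alX; rewrite ler_peMl// prodr_ge0// => j _; exact: ltW.
have [I0 dI0] := stable_basis (n0 : (1 < n.+1)%N) st.
have [I [dI srt XI]] := minimal_tuple X0 dI0.
have IE : ([ffun k => I k] : {ffun _ -> _}) = I :> (_ -> _).
  by apply/funext => k; rewrite ffunE.
exists [ffun k => I k], (fun k => X (I k).1); rewrite IE; split => //.
- by move=> k; rewrite X0 srt.
- move=> k; under eq_bigr do rewrite mxE.
  exact: real_part_le_eval.
move=> P; split.
  rewrite /A0 ler_pdivlMr ?exprn_gt0// mulrC.
  apply: (@tuple_volume_le_height _ _ _ l X I al) => //; first exact: ltW.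
  move=> T dT; apply: (le_trans (min_height_le dT)).
  rewrite -big_split /= le_eqVlt; apply/orP; left; apply/eqP; apply: eq_bigr => j _.
  by rewrite {1}Ll -scalemxAl hermitian_normZ.
(* A coordinate is a quotient of two determinants, bounded by [liouville] from below and from above;
   [kappa] cancels. *)
move=> k; pose eta := (LB ^+ (liouville_size n.+1 d.+1).+1)^-1.
have eta0 : 0 < eta by rewrite invr_gt0 exprn_gt0.
have etaI q k' : (real_part (l q.1) q.2 *m invmx (real_parts_mx l I)) 0 k' != 0 ->
    eta <= `|(real_part (l q.1) q.2 *m invmx (real_parts_mx l I)) 0 k'|.
  rewrite coordE//; set I' := fun i => _.
  rewrite mulf_eq0 negb_or => /andP[dI' _].
  have nzI' : kappa * `|\det (real_parts_mx l I')| != 0.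
    by rewrite mulf_neq0 ?normr_eq0// gt_eqF.
  have [_ /(_ nzI') h'] := kapI I'; have [DLB _] := kapI I.
  have dIp : 0 < `|\det (real_parts_mx l I)| by rewrite normr_gt0.
  rewrite normrM normfV /eta exprS -/G ler_pdivlMr// mulrC ler_pdivrMr ?(mulr_gt0 LB0 G0)//.
  rewrite -(ler_pM2l kap0); apply: (le_trans DLB).
  rewrite -[leLHS]mulr1; apply: le_trans (ler_wpM2l (ltW LB0) h') _.
  by rewrite le_eqVlt; apply/orP; left; apply/eqP; ring.
have := tuple_product_le_ratio X0 dI X1 l0 st XI srt eta0 etaI k.
set p := \prod_k _; set rr := _ / _ => hfar.
have nzI : kappa * `|\det (real_parts_mx l I)| != 0.
  by rewrite mulf_neq0 ?normr_eq0// gt_eqF.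
have [_ /(_ nzI)] := kapI I; rewrite -/G; set D := `|_| => hD.
have D0 : 0 < D by rewrite normr_gt0.
have DV : D^-1 <= kappa_bound n d.+1 y * G.
  rewrite -[leLHS]mul1r ler_pdivrMr//; apply: (le_trans hD).
  by rewrite -mulrA (mulrC D) mulrA ler_pM2r// ler_pM2r.
have pr : p ^+ d.+1 * rr <= (LB ^+ (liouville_size n.+1 d.+1).+1) ^+ (d.+1 * n.+1).
  by move: hfar; rewrite /eta exprVn ler_pdivrMr ?exprn_gt0 ?mul1r// exprn_gt0.
rewrite /P -/p -/D expr_div_n -mulrA [_^-1 * _]mulrC mulrA -exprVn /far_bound.
have rr0 : 0 <= rr by rewrite divr_ge0// ltW.
apply: ler_pM => //.
- by rewrite mulr_ge0// exprn_ge0// prodr_ge0// => i _; exact: ltW.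
- by rewrite exprn_ge0// invr_ge0 ltW.
- by rewrite lerXn2r ?nnegrE ?invr_ge0 ?(ltW D0) ?(ltW (mulr_gt0 K0 G0)).
Qed.

End Main.

Theorem theorem4 (R : realType) (n d : nat) (hn : (2 <= n)%N) (hd : (1 <= d)%N) :
  exists K : R, 0 < K /\
    forall F : {mpoly int[n]},
      let FR : {mpoly R[n]} := map_mpoly intr F in
      decomposable_form d FR ->
      (form_volume FR < +oo)%E ->
      (forall x : 'rV[rat]_n, x != 0 -> meval (x 0) (map_mpoly intr F) != 0) ->
      (form_volume FR <=
        (K * min_height d FR `^ (- (n%:R / d%:R)) *
           (1 + `|ln (min_height d FR)|) ^+ (n - 1))%:E)%E.
Proof.
case: n d hn hd => // n [//|d]; rewrite ltnS => n0 _.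
have [c [e [c1 growth]]] := @far_bound_growth R n d.+1.
have [K1 [K11 logP]] := log_bound e c1.
have q1 := shell_ratio_lt1 R n0 (ltn0Sn d).
set g := (1 - shell_ratio R n d.+1)^-1.
have g0 : 0 < g by rewrite invr_gt0 subr_gt0.
have K10 : 0 < K1 by exact: lt_le_trans K11.
set J := #|{ffun 'I_n.+1 -> 'I_d.+1 * bool}|.
have J0 : (0 < J)%N by apply/card_gt0P; exists [ffun=> (ord0, true)].
(* [J] counts the tuples, [(2 * n.+1%:R) ^+ n.+1] is left from the [d.+1]-st root of [A0], and
   [K1 + g] times [s] bounds [w%:R + g] because [s] is at least 1. *)
exists (J%:R * 4 ^+ n.+1 * (2 * n.+1%:R) ^+ n.+1 * (K1 + g) ^+ n); split.
  by rewrite !mulr_gt0 ?exprn_gt0 ?mulr_gt0 ?addr_gt0 ?ltr0n.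
move=> F FR [_ [L FL]] Vfin nz.
have m0 := min_height_gt0 FL nz.
set m := min_height _ _ in m0 *.
have [w [wc wK]] := logP m m0.
have y1 : 1 <= 1 + 2 * m by rewrite lerDl mulr_ge0// ltW.
have /andP[_ /le_trans/(_ wc) wP] := growth _ y1.
apply: le_trans (volume_le n0 FL Vfin nz wP) _.
rewrite lee_fin -/J -/g -/m.
set s := 1 + `|ln m|.
have s1 : 1 <= s by rewrite lerDl.
have -> : ((2 * n.+1%:R) ^+ (d.+1 * n.+1) / m ^+ n.+1) `^ d.+1%:R^-1 =
    (2 * n.+1%:R) ^+ n.+1 * m `^ (- (n.+1%:R / d.+1%:R)).
  rewrite powRM ?exprn_ge0 ?mulr_ge0// ?invr_ge0 ?exprn_ge0 ?(ltW m0)//; congr (_ * _).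
    by rewrite mulnC exprM -powR_exprAC ?powR_invn_Xn ?exprn_ge0 ?mulr_ge0.
  by rewrite -powR_invn ?(ltW m0)// -powRrM mulNr.
rewrite subn1 /=; set a := m `^ _; set p := 4 ^+ _; set r := (2 * _) ^+ _.
have -> : J%:R * p * (r * a) * (w%:R + g) ^+ n = (J%:R * p * r * a) * (w%:R + g) ^+ n by ring.
have -> : J%:R * p * r * (K1 + g) ^+ n * a * s ^+ n = (J%:R * p * r * a) * ((K1 + g) * s) ^+ n.
  by rewrite exprMn; ring.
have c0 : 0 <= J%:R * p * r * a.
  by rewrite !mulr_ge0 ?exprn_ge0 ?mulr_ge0 ?powR_ge0.
rewrite ler_wpM2l// lerXn2r ?nnegrE ?addr_ge0 ?(ltW g0)//.
  by rewrite mulr_ge0 ?addr_ge0 ?(ltW g0) ?(ltW K10).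
by rewrite mulrDl; apply: lerD; [exact: wK|rewrite ler_peMr// ltW].
Qed.
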